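(* Let $N\ge2$ be an even integer and let $U(t)\in\mathbb R^N$ solve $$\frac{d}{dt}U+\frac12\partial_h(U^{.2})=\Delta_hU,\quad t>0,\qquad U|_{t=0}=U^0\in\mathbb R^N.$$ Suppose $f$ is a real-valued function on $\mathbb T$ with $\widehat f$ supported in $\{|k|\le\frac N2\}$ and $\widehat f(\frac N2)=\widehat f(-\frac N2)$, and let $(U^0)_j=f(\frac jN)$ for all $0\le j\le N-1$. Then for all $N\ge N_0=N_0(\|f\|_2)$, $$\sup_{t\ge0}\|U(t)\|_\infty\le\|f\|_\infty+\gamma_1\cdot N^{-\frac12}\cdot(1+\|\partial_xf\|_2^2),$$ where $\gamma_1>0$ depends only on $\|f\|_2$.
   Context: $\mathbb T=[0,1)$ periodic; $\|f\|_2$, $\|f\|_\infty$ are the $L^2(\mathbb T)$, $L^\infty(\mathbb T)$ norms and $\widehat f(k)=\int_0^1f(x)e^{-2\pi ikx}dx$. For $U=(U_0,\dots,U_{N-1})^T$: $\tilde U_k=\frac1N\sum_{j=0}^{N-1}U_je^{-2\pi ikj/N}$, $U_j=\sum_{k=-\frac N2+1}^{N/2}\tilde U_ke^{2\pi ikj/N}$; $\partial_h$ and $\Delta_h$ correspond to the discrete Fourier multipliers $2\pi ik$ and $-4\pi^2k^2$ for $-\frac N2<k\le\frac N2$ (for real vectors, the real part of the result is taken, so that the $k=\frac N2$ mode contributes $0$ to $\partial_h$ at the grid points). $U^{.2}=((U_0)^2,\dots,(U_{N-1})^2)^T$, $\|U\|_\infty=\max_j|U_j|$. *)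

(* Defs.v *)
From HB Require Import structures.
From mathcomp Require Import all_boot all_order all_algebra.
From mathcomp Require Import all_classical all_reals all_analysis.
From mathcomp.real_closed Require Import complex.

Set Implicit Arguments.
Unset Strict Implicit.
Unset Printing Implicit Defensive.
Import Order.TTheory GRing.Theory Num.Theory.
Import numFieldNormedType.Exports.

Local Open Scope classical_set_scope.
Local Open Scope ring_scope.
Local Open Scope complex_scope.

Section Torus.
Variable R : realType.

(* e^{2 pi i x} *)
Definition cexp2pi (x : R) : R[i] := cos (2 * pi * x) +i* sin (2 * pi * x).

(* Functions on the torus are represented by 1-periodic functions on R, and
   the torus by its fundamental domain [0, 1). *)
Definition torus_measure := mrestr (@lebesgue_measure R)
  (measurable_itv `[(0 : R), 1[).

HB.instance Definition _ := Measure.on torus_measure.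

Definition cintegral (g : R -> R[i]) : R[i] :=
  (\int[torus_measure]_x complex.Re (g x)) +i*
  (\int[torus_measure]_x complex.Im (g x)).

Definition fourier_coef (f : R -> R) (k : int) : R[i] :=
  cintegral (fun x => (f x)%:C * cexp2pi (- (k%:~R * x))).

(* The value in R of an extended-real norm; for a continuous 1-periodic
   function that norm is finite. *)
Definition L2norm (f : R -> R) : R :=
  fine ('N[torus_measure]_2%:E[EFin \o f])%E.

Definition Linfnorm (f : R -> R) : \bar R :=
  ('N[torus_measure]_+oo[EFin \o f])%E.

End Torus.

Section Discrete.
Variables (R : realType) (N : nat).
Implicit Types (U : 'cV[R]_N) (k : int).

Definition grid (j : 'I_N) : R := j%:R / N%:R.

(* For N even, m |-> freq m is a bijection from {0, ..., N - 1} onto the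
   integers k with - N / 2 < k <= N / 2. *)
Definition freq (m : 'I_N) : int := m%:Z - (N./2)%:Z + 1.

Definition dft U k : R[i] :=
  N%:R^-1 * \sum_(j < N) (U j 0)%:C * cexp2pi (- (k%:~R * grid j)).

Definition fourier_mult (sigma : int -> R[i]) U : 'cV[R]_N :=
  \col_j complex.Re
    (\sum_(m < N)
       sigma (freq m) * dft U (freq m) * cexp2pi ((freq m)%:~R * grid j)).

Definition partial_h U : 'cV[R]_N :=
  fourier_mult (fun k => 0 +i* (2 * pi * k%:~R)) U.

Definition Delta_h U : 'cV[R]_N :=
  fourier_mult (fun k => (- (4 * pi ^+ 2 * k%:~R ^+ 2))%:C) U.

Definition sqr_vec U : 'cV[R]_N := map_mx (fun x => x ^+ 2) U.

Definition burgers_solution (U0 : 'cV[R]_N) (U : R -> 'cV[R]_N) : Prop :=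
  [/\ {within `[0, +oo[, continuous U}, U 0 = U0 &
      forall t : R, 0 < t -> exists dU : 'cV[R]_N,
        is_derive t 1 U dU /\
        dU + 2^-1 *: partial_h (sqr_vec (U t)) = Delta_h (U t)].

End Discrete.

(* Main.v *)
(** Let u(t, x) be the trigonometric interpolant of U(t). It solves
    u_t + u u_x = u_xx + h_x, where h is half the aliasing error of u^2, i.e. u^2 minus its
    interpolant without the mode N/2. Comparing u^2 with its interpolant cell by cell gives
    |h|_2 <= C N^-1 |u|_oo |u_x|_2. As |u|_oo^2 <= C N |u|_2^2, for N large compared with
    |f|_2^2 the aliasing is absorbed by the dissipation, so |u|_2^2 decreases at least at rate
    |u_x|_2^2; then (1 + |u_x|_2^2) exp(C |u|_2^2) is nonincreasing as well, and |u_x|_2^2 is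
    bounded for all times by a multiple of 1 + |f'|_2^2. With M = |f|_oo and p the positive
    part of u - M or -u - M, the transport term does not contribute to the evolution of
    int p^4, hence int p^4 <= C N^-2 sup(p^2) (1 + |f'|_2^2), and interpolating between this
    and |u_x|_2 yields sup p <= C N^(-1/2) (1 + |f'|_2^2). *)
Require Import Defs.
From HB Require Import structures.
From mathcomp Require Import all_boot all_order all_algebra.
From mathcomp Require Import all_classical all_reals all_analysis.
From mathcomp Require Import measurable_realfun ess_sup_inf.
From mathcomp.real_closed Require Import complex.
From mathcomp Require Import ring lra zify.

Set Implicit Arguments.
Unset Strict Implicit.
Unset Printing Implicit Defensive.
Import Order.TTheory GRing.Theory Num.Theory.
Import numFieldNormedType.Exports.

Local Open Scope classical_set_scope.
Local Open Scope ring_scope.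

(** * Continuity and derivatives on the real line *)

Section Calculus.
Context {R : realType}.
Implicit Types (f g h : R -> R) (x a b : R).

(** The obstacle is that the scheme has no pointwise maximum principle: interpolation is nonlocal,
    and a small bound is available for h in L^2 but not for h_x. Hence h_x is always integrated by
    parts against a test function, and in the gradient estimate u_t - u_xx is bounded as a whole,
    without separating h_x from the transport term. Each bound on int h^2 is a small multiple of
    |u_x|_2^2. The decay of |u|_2^2 pays for it, which makes all estimates uniform in time. The
    fourth power of p keeps the test function p^3 continuously differentiable, so that integration
    by parts stays classical across the kink. The price is a factor Z = sup p^2 on the right; it
    cancels at the end, because p^4 <= Z k / N for all t and x gives Z^2 <= Z k / N. The comparison
    with M needs |u| <= M at time 0 on the whole circle and not only at the nodes. This holds
    because the initial interpolant is f itself: a band-limited f is a trigonometric polynomial, by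
    uniqueness of Fourier coefficients for continuous functions. *)

Lemma cont_add f g : continuous f -> continuous g -> continuous (fun x => f x + g x).
Proof. by move=> cf cg x; apply: cvgD; [exact: cf|exact: cg]. Qed.

Lemma cont_sub f g : continuous f -> continuous g -> continuous (fun x => f x - g x).
Proof. by move=> cf cg x; apply: cvgB; [exact: cf|exact: cg]. Qed.

Lemma cont_opp f : continuous f -> continuous (fun x => - f x).
Proof. by move=> cf x; apply: cvgN; exact: cf. Qed.

Lemma cont_mul f g : continuous f -> continuous g -> continuous (fun x => f x * g x).
Proof. by move=> cf cg x; apply: cvgM; [exact: cf|exact: cg]. Qed.

Lemma cont_scale c f : continuous f -> continuous (fun x => c * f x).
Proof. by move=> cf; apply: cont_mul => //; exact: cst_continuous. Qed.

Lemma cont_exp f n : continuous f -> continuous (fun x => f x ^+ n).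
Proof. by move=> cf x; exact: (continuous_comp (cf x) (@exprn_continuous _ n _)). Qed.

Lemma cont_norm f : continuous f -> continuous (fun x => `|f x|).
Proof. by move=> cf x; apply: cvg_norm; exact: cf. Qed.

Lemma cont_max f g : continuous f -> continuous g ->
  continuous (fun x => Num.max (f x) (g x)).
Proof. by move=> cf cg x; apply: continuous_max; [exact: cf|exact: cg]. Qed.

Lemma cont_comp g f : continuous f -> continuous g -> continuous (fun x => g (f x)).
Proof. by move=> cf cg x; exact: (continuous_comp (cf x) (cg (f x))). Qed.

Lemma cont_sum (I : Type) (r : seq I) (P : pred I) (F : I -> R -> R) :
  (forall i, P i -> continuous (F i)) ->
  continuous (fun x => \sum_(i <- r | P i) F i x).
Proof.
move=> cF; elim: r => [|i r IH].
  by under eq_fun do rewrite big_nil; exact: cst_continuous.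
under eq_fun do rewrite big_cons; case: (boolP (P i)) => // Pi.
by apply: cont_add => //; exact: cF.
Qed.

Lemma der_add x f g a b : is_derive x 1 f a -> is_derive x 1 g b ->
  is_derive x 1 (fun y => f y + g y) (a + b).
Proof. by move=> df dg; exact: is_deriveD. Qed.

Lemma der_sub x f g a b : is_derive x 1 f a -> is_derive x 1 g b ->
  is_derive x 1 (fun y => f y - g y) (a - b).
Proof. by move=> df dg; exact: is_deriveB. Qed.

Lemma der_mul x f g a b : is_derive x 1 f a -> is_derive x 1 g b ->
  is_derive x 1 (fun y => f y * g y) (a * g x + f x * b).
Proof.
move=> df dg; have := is_deriveM df dg.
by rewrite /GRing.scale/= addrC [g x * _]mulrC.
Qed.

Lemma der_scale x c f a : is_derive x 1 f a -> is_derive x 1 (fun y => c * f y) (c * a).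
Proof.
move=> df; have := der_mul (is_derive_cst c x 1) df.
by rewrite mul0r add0r.
Qed.

Lemma der_exp x f n a : is_derive x 1 f a ->
  is_derive x 1 (fun y => f y ^+ n.+1) (n.+1%:R * f x ^+ n * a).
Proof.
move=> df; have := @is_deriveX _ _ f n.+1 _ _ _ df.
by rewrite exprfctE.
Qed.

Lemma der_comp x g f a b : is_derive (f x) 1 g b -> is_derive x 1 f a ->
  is_derive x 1 (fun y => g (f y)) (b * a).
Proof. by move=> dg df; exact: (is_derive1_comp dg df). Qed.

Lemma der_sum x (I : Type) (r : seq I) (F : I -> R -> R) (dF : I -> R) :
  (forall i, is_derive x 1 (F i) (dF i)) ->
  is_derive x 1 (fun y => \sum_(i <- r) F i y) (\sum_(i <- r) dF i).
Proof.
move=> dFi; elim: r => [|i r IH].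
  by under eq_fun do rewrite big_nil; rewrite big_nil; exact: is_derive_cst.
by under eq_fun do rewrite big_cons; rewrite big_cons; exact: der_add.
Qed.

Lemma der_cont f df : (forall x, is_derive x 1 f (df x)) -> continuous f.
Proof.
move=> d x; apply/differentiable_continuous/derivable1_diffP.
by have [] := d x.
Qed.

(** Differentiability is asked only for t > 0, as in the differential equation; continuity carries
    the comparison down to the initial time. *)
Lemma nonincreasing_from0 f df : continuous f ->
  (forall t : R, 0 < t -> is_derive t 1 f (df t)) ->
  (forall t : R, 0 < t -> df t <= 0) -> forall t : R, 0 <= t -> f t <= f 0.
Proof.
move=> cf d d0 t; rewrite le_eqVlt => /predU1P[<-//|t0].
apply: (@ler0_derive1_le_cc _ f 0 t) => //; rewrite ?in_itv/= ?lexx ?ltW//.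
- move=> x; rewrite in_itv/= => /andP[x0 _].
  by have [] := d _ x0.
- move=> x; rewrite in_itv/= => /andP[x0 _].
  by rewrite derive1E (@derive_val _ _ _ _ _ _ _ (d _ x0)) d0.
- exact: continuous_subspaceT.
Qed.

End Calculus.
Arguments cont_exp {R f} n.

(** * Integrals of continuous functions *)

Section Integral.
Context {R : realType}.
Implicit Types (f g h : R -> R) (x a b c : R).

Notation mu := (@lebesgue_measure R).

Definition itg a b f : R := \int[mu]_(x in `[a, b]) f x.

Lemma itg_integrable a b f : continuous f -> mu.-integrable `[a, b] (EFin \o f).
Proof.
move=> cf; apply: continuous_compact_integrable; first exact: segment_compact.
exact: continuous_subspaceT.
Qed.

Lemma itgD a b f g : continuous f -> continuous g ->
  itg a b (fun x => f x + g x) = itg a b f + itg a b g.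
Proof. by move=> cf cg; rewrite /itg RintegralD//; exact: itg_integrable. Qed.

Lemma itgB a b f g : continuous f -> continuous g ->
  itg a b (fun x => f x - g x) = itg a b f - itg a b g.
Proof. by move=> cf cg; rewrite /itg RintegralB//; exact: itg_integrable. Qed.

Lemma itgZ a b c f : continuous f -> itg a b (fun x => c * f x) = c * itg a b f.
Proof. by move=> cf; rewrite /itg RintegralZl//; exact: itg_integrable. Qed.

Lemma itg_le a b f g : continuous f -> continuous g ->
  (forall x, a <= x <= b -> f x <= g x) -> itg a b f <= itg a b g.
Proof.
by move=> cf cg fg; apply: le_Rintegral => //; exact: itg_integrable.
Qed.

Lemma itg_ge0 a b f : (forall x, a <= x <= b -> 0 <= f x) -> 0 <= itg a b f.
Proof.
by move=> f0; apply: Rintegral_ge0 => x /=; rewrite in_itv/=; exact: f0.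
Qed.

Lemma eq_itg a b f g : (forall x, a <= x <= b -> f x = g x) ->
  itg a b f = itg a b g.
Proof. by move=> fg; apply: eq_Rintegral => x; rewrite inE/= in_itv/=; exact: fg. Qed.

Lemma itg_derive a b F f : a <= b -> continuous f ->
  (forall x, is_derive x 1 F (f x)) -> itg a b f = F b - F a.
Proof.
rewrite le_eqVlt => /predU1P[<- _ _|ab cf dF].
  by rewrite /itg set_itv1 Rintegral_set1 subrr.
have cF : continuous F by exact: der_cont dF.
rewrite /itg /Rintegral (@continuous_FTC2 _ f F)//.
- exact: continuous_subspaceT.
- split.
  + by move=> x _; have [] := dF x.
  + exact/cvg_at_right_filter/cF.
  + exact/cvg_at_left_filter/cF.
- by move=> x _; rewrite derive1E (@derive_val _ _ _ _ _ _ _ (dF x)).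
Qed.

Lemma itg_cst a b c : a <= b -> itg a b (fun=> c) = c * (b - a).
Proof.
move=> ab.
have d x : is_derive x 1 (fun x => c * x) c.
  by rewrite -[X in is_derive _ _ _ X]mulr1; exact: der_scale.
by rewrite (itg_derive ab _ d) ?mulrBr//; exact: cst_continuous.
Qed.

Lemma itg_split a b c f : a <= b -> b <= c -> continuous f ->
  itg a c f = itg a b f + itg b c f.
Proof.
move=> ab bc cf; rewrite /itg -(@Rintegral_itv_obnd_cbnd _ b (BRight c)); last first.
  by apply: integrableS (itg_integrable a c cf) => //; apply: subset_itv;
    rewrite bnd_simp.
rewrite -(@Rintegral_itvB _ _ (BLeft a)) ?bnd_simp//; last exact: itg_integrable.
by rewrite addrC subrK.
Qed.

(** Equal end values cancel the boundary term, as on the circle. *)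
Lemma itg_ibp F G f g : continuous f -> continuous g ->
  (forall x, is_derive x 1 F (f x)) -> (forall x, is_derive x 1 G (g x)) ->
  F 1 = F 0 -> G 1 = G 0 ->
  itg 0 1 (fun x => f x * G x) = - itg 0 1 (fun x => F x * g x).
Proof.
move=> cf cg dF dG F1 G1; apply/eqP; rewrite -addr_eq0.
have cF : continuous F by exact: der_cont dF.
have cG : continuous G by exact: der_cont dG.
rewrite -itgD; [|exact: cont_mul..].
have d x : is_derive x 1 (fun x => F x * G x) (f x * G x + F x * g x).
  exact: der_mul.
rewrite (itg_derive ler01 _ d) ?F1 ?G1 ?subrr//.
by apply: cont_add; exact: cont_mul.
Qed.

(* The variation of F over [0, 1] bounds F x - F y, for every y; average over y. *)
Lemma sup_le_itg F f x : continuous f -> (forall x, is_derive x 1 F (f x)) ->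
  0 <= x <= 1 -> F x <= itg 0 1 F + itg 0 1 (fun y => `|f y|).
Proof.
move=> cf dF /andP[x0 x1].
have cF : continuous F by exact: der_cont dF.
have cnf := cont_norm cf.
have H y : 0 <= y <= 1 -> F x - itg 0 1 (fun y => `|f y|) <= F y.
  move=> /andP[y0 y1]; rewrite lerBlDr -lerBlDl.
  have pos a b : 0 <= itg a b (fun y => `|f y|) by apply: itg_ge0.
  have [xy|/ltW yx] := leP x y.
    have -> : F x - F y = itg x y (fun z => -1 * f z).
      by rewrite itgZ// (itg_derive xy cf dF) mulN1r opprB.
    rewrite (itg_split x0 x1)// (itg_split xy y1)//.
    apply: (@le_trans _ _ (itg x y (fun y => `|f y|))).
      apply: itg_le => //; first exact: cont_scale.
      by move=> z _; rewrite mulN1r -normrN ler_norm.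
    by have := pos 0 x; have := pos y 1; lra.
  rewrite -(itg_derive yx cf dF) (itg_split y0 y1)// (itg_split yx x1)//.
  apply: (@le_trans _ _ (itg y x (fun y => `|f y|))).
    by apply: itg_le => // z _; rewrite ler_norm.
  by have := pos 0 y; have := pos x 1; lra.
rewrite -lerBlDr.
rewrite -[leLHS]mulr1 -[X in _ * X](subr0 1) -itg_cst//.
by apply: itg_le => //; exact: cst_continuous.
Qed.

(** Cauchy-Schwarz in the form of a nonnegative variance: expand the integral over [a, x] of (f -
    l)^2, where l is the mean slope of F there, then enlarge [a, x] to [a, b]. *)
Lemma sqr_increment_le F f a b x : continuous f ->
  (forall x, is_derive x 1 F (f x)) -> a <= x <= b ->
  (F x - F a) ^+ 2 <= (b - a) * itg a b (fun y => f y ^+ 2).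
Proof.
move=> cf dF /andP[]; rewrite le_eqVlt => /predU1P[<-|ax] xb.
  rewrite subrr expr0n/= mulr_ge0 ?subr_ge0//; apply: itg_ge0 => *.
  exact: sqr_ge0.
have cf2 := cont_exp 2 cf.
pose l := (F x - F a) / (x - a).
have xa0 : 0 < x - a by rewrite subr_gt0.
have h : 0 <= itg a x (fun y => f y ^+ 2) - (F x - F a) ^+ 2 / (x - a).
  have : 0 <= itg a x (fun y => (f y - l) ^+ 2).
    by apply: itg_ge0 => *; exact: sqr_ge0.
  rewrite (_ : (fun y => (f y - l) ^+ 2) =
    (fun y => (f y ^+ 2 - (2 * l) * f y) + l ^+ 2)); last by apply/funext => y; ring.
  have cst : continuous (fun _ : R => l ^+ 2) by exact: cst_continuous.
  rewrite itgD//; last by apply: cont_sub => //; exact: cont_scale.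
  rewrite itgB//; last exact: cont_scale.
  rewrite itgZ// (itg_derive (ltW ax) cf dF) itg_cst; last exact: ltW.
  congr (_ <= _); rewrite /l; field; exact: lt0r_neq0.
have h2 : itg a x (fun y => f y ^+ 2) <= itg a b (fun y => f y ^+ 2).
  rewrite (itg_split (ltW ax) xb)//.
  by rewrite lerDl; apply: itg_ge0 => *; exact: sqr_ge0.
have : (F x - F a) ^+ 2 <= (x - a) * itg a x (fun y => f y ^+ 2).
  by rewrite mulrC -ler_pdivrMr// -subr_ge0.
move=> /le_trans; apply; apply: ler_pM => //; first exact: ltW.
- by apply: itg_ge0 => *; exact: sqr_ge0.
- by rewrite lerB.
Qed.

Lemma itg_cells (N : nat) f : (0 < N)%N -> continuous f ->
  itg 0 1 f = \sum_(j < N) itg (j%:R / N%:R) (j.+1%:R / N%:R) f.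
Proof.
move=> N0 cf.
suff H m : itg 0 (m%:R / N%:R) f = \sum_(j < m) itg (j%:R / N%:R) (j.+1%:R / N%:R) f.
  by rewrite -H divff// pnatr_eq0 -lt0n.
elim: m => [|m IH].
  by rewrite big_ord0 mul0r /itg set_itv1 Rintegral_set1.
rewrite big_ord_recr/= -IH -itg_split//.
by rewrite ler_wpM2r ?invr_ge0// ler_nat.
Qed.

Let cell_width (N j : nat) : (j.+1%:R / N%:R - j%:R / N%:R :> R) = N%:R^-1.
Proof. by rewrite -mulrBl -natrB// subSnn mul1r. Qed.

Let cell_le (N j : nat) : (j%:R / N%:R <= j.+1%:R / N%:R :> R).
Proof. by rewrite ler_wpM2r ?invr_ge0// ler_nat. Qed.

Lemma sum_sqr_increment_le (N : nat) F f : (0 < N)%N -> continuous f ->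
  (forall x, is_derive x 1 F (f x)) ->
  \sum_(j < N) (F (j.+1%:R / N%:R) - F (j%:R / N%:R)) ^+ 2 <=
  N%:R^-1 * itg 0 1 (fun y => f y ^+ 2).
Proof.
move=> N0 cf dF; rewrite (itg_cells N0); last exact: cont_exp.
rewrite mulr_sumr; apply: ler_sum => j _.
pose p : R := j%:R / N%:R; pose q : R := j.+1%:R / N%:R.
have pq : p <= q by exact: cell_le.
have jj : p <= q <= q by rewrite pq lexx.
have := sqr_increment_le cf dF jj.
by rewrite cell_width.
Qed.

(** On each cell F^2 <= 2 F(a)^2 + 2 (F - F(a))^2 with a the left node, and the squared increment is
    at most the cell width times the derivative energy of the cell. Small nodal values and a bounded
    derivative thus make a function small in L^2. *)
Lemma itg_sqr_le_cells (N : nat) F f : (0 < N)%N -> continuous f ->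
  (forall x, is_derive x 1 F (f x)) ->
  itg 0 1 (fun y => F y ^+ 2) <=
  2 * N%:R^-1 * \sum_(j < N) F (j%:R / N%:R) ^+ 2 +
  2 * N%:R^-1 ^+ 2 * itg 0 1 (fun y => f y ^+ 2).
Proof.
move=> N0 cf dF.
have cF : continuous F by exact: der_cont dF.
have cf2 := cont_exp 2 cf; have cF2 := cont_exp 2 cF.
rewrite (itg_cells N0 cF2) (itg_cells N0 cf2) !mulr_sumr -big_split/=.
apply: ler_sum => j _; set a := j%:R / N%:R; set b := j.+1%:R / N%:R.
set I := itg a b (fun y => f y ^+ 2).
rewrite [leRHS](_ : _ = (2 * F a ^+ 2 + 2 * N%:R^-1 * I) * (b - a)); last first.
  by rewrite cell_width; ring.
rewrite -itg_cst ?cell_le//; apply: itg_le => //; first exact: cst_continuous.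
move=> x axb; have := sqr_increment_le cf dF axb.
rewrite cell_width -/I => h; have := sqr_ge0 (F x - 2 * F a); nra.
Qed.

End Integral.

(** * Continuity and differentiation under the integral sign *)

Section UnderIntegral.
Context {R : realType}.
Implicit Types (f : R -> R) (t x a b : R).

Notation mu := (@lebesgue_measure R).

Lemma cont_bounded f a b : a <= b -> continuous f ->
  exists2 B : R, 0 <= B & forall x, a <= x <= b -> `|f x| <= B.
Proof.
move=> ab cf; have cnf := cont_norm cf.
have [c cab fc] := @EVT_max _ _ _ _ ab (continuous_subspaceT cnf).
by exists `|f c| => // x xab; apply: fc; rewrite in_itv.
Qed.

Context (m : nat).
Implicit Types (c g : 'I_m -> R -> R).

(** Finitely many time coefficients times fixed profiles: regularity in t and bounds uniform over a
    compact time interval are inherited from the coefficients, which provides the dominating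
    constants below. *)
Definition separated c g t x : R := \sum_i c i t * g i x.

Lemma separated_contr c g t : (forall i, continuous (g i)) ->
  continuous (separated c g t).
Proof. by move=> cg; apply: cont_sum => i _; exact: cont_scale. Qed.

Lemma separated_contl c g x : (forall i, continuous (c i)) ->
  continuous (fun t => separated c g t x).
Proof.
move=> cc; apply: cont_sum => i _; apply: cont_mul; first exact: cc.
exact: cst_continuous.
Qed.

Lemma separated_deriver c g g' t x : (forall i, is_derive x 1 (g i) (g' i x)) ->
  is_derive x 1 (separated c g t) (separated c g' t x).
Proof. by move=> dg; apply: der_sum => i; exact: der_scale. Qed.

Lemma separated_derivel c c' g t x : (forall i, is_derive t 1 (c i) (c' i t)) ->
  is_derive t 1 (fun s => separated c g s x) (separated c' g t x).
Proof.
move=> dc; apply: der_sum => i.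
have := der_scale (g i x) (dc i); rewrite mulrC; congr is_derive.
by apply/funext => y; rewrite mulrC.
Qed.

Lemma separated_bounded c g a b : a <= b -> (forall i, continuous (c i)) ->
  (forall i, continuous (g i)) ->
  exists2 B : R, 0 <= B & forall t x, a <= t <= b -> 0 <= x <= 1 ->
    `|separated c g t x| <= B.
Proof.
move=> ab cc cg.
have /choice[C C1] : forall i, exists C : R, 0 <= C /\
    forall t, a <= t <= b -> `|c i t| <= C.
  by move=> i; have [C C0 Cb] := cont_bounded ab (cc i); exists C.
have /choice[G G1] : forall i, exists G : R, 0 <= G /\
    forall x, 0 <= x <= 1 -> `|g i x| <= G.
  by move=> i; have [G G0 Gb] := cont_bounded ler01 (cg i); exists G.
exists (\sum_i C i * G i).
  by apply: sumr_ge0 => i _; rewrite mulr_ge0//; [have [] := C1 i|have [] := G1 i].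
move=> t x tab x01; apply: (le_trans (ler_norm_sum _ _ _)); apply: ler_sum => i _.
by rewrite normrM ler_pM//; [have [_] := C1 i; exact|have [_] := G1 i; exact].
Qed.

Lemma itg_cont c g (Psi : R -> R) : (forall i, continuous (c i)) ->
  (forall i, continuous (g i)) -> continuous Psi ->
  continuous (fun t => itg 0 1 (fun x => Psi (separated c g t x))).
Proof.
move=> cc cg cPsi t.
have t11 : t - 1 <= t + 1 by lra.
have [B B0 hB] := separated_bounded t11 cc cg.
have BB : - B <= B by lra.
have [K K0 hK] := cont_bounded BB cPsi.
have := @continuity_under_integral R _ _ mu
  (fun t x => Psi (separated c g t x)) `[0, 1] (measurable_itv _) (t - 1) (t + 1)
  _ _ (fun=> K) _ _ t.
apply.
- move=> s _; apply: itg_integrable; apply: cont_comp => //.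
  exact: separated_contr.
- apply: aeW => x _ s _.
  by apply: cont_comp => //; exact: separated_contl.
- by apply: (itg_integrable 0 1); exact: cst_continuous.
- move=> s /=; rewrite in_itv/= => /andP[/ltW s1 /ltW s2]; apply: aeW => x /=.
  rewrite in_itv/= => x01; apply: hK; rewrite -ler_norml.
  by apply: hB => //; rewrite s1 s2.
- by rewrite inE/= in_itv/=; lra.
Qed.

(** On the window ]t / 2, t + 1[ all times are positive, so the coefficients are differentiable, and
    the time derivative of the integrand is dominated by the constant [K * B']. *)
Lemma itg_derivl c c' g (Psi psi : R -> R) : (forall i, continuous (c i)) ->
  (forall i, continuous (c' i)) -> (forall i, continuous (g i)) ->
  (forall i t, 0 < t -> is_derive t 1 (c i) (c' i t)) ->
  continuous psi -> (forall s : R, is_derive s 1 Psi (psi s)) ->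
  forall t, 0 < t ->
  is_derive t 1 (fun t => itg 0 1 (fun x => Psi (separated c g t x)))
   (itg 0 1 (fun x => psi (separated c g t x) * separated c' g t x)).
Proof.
move=> cc cc' cg dc cpsi dPsi t t0.
have cPsi : continuous Psi by exact: der_cont dPsi.
have h2t : t / 2 <= t + 1 by lra.
have [B B0 hB] := separated_bounded h2t cc cg.
have [B' B'0 hB'] := separated_bounded h2t cc' cg.
have BB : - B <= B by lra.
have [K K0 hK] := cont_bounded BB cpsi.
pose F s x := Psi (separated c g s x).
have dF (s x : R) : 0 < s -> is_derive s 1 (F ^~ x)
    (psi (separated c g s x) * separated c' g s x).
  move=> s0; apply: (@der_comp _ _ Psi (fun s => separated c g s x)) => //.
  by apply: separated_derivel => i; exact: dc.
have p1 s x : 0 < s -> partial1of2 F s x = psi (separated c g s x) * separated c' g s x.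
  by move=> s0; rewrite partial1of2E (@derive_val _ _ _ _ _ _ _ (dF s x s0)).
have It : `](t / 2), (t + 1)[%classic t by rewrite /= in_itv/=; lra.
have I1 s : `](t / 2), (t + 1)[%classic s -> mu.-integrable `[0, 1] (EFin \o F s).
  move=> _; apply: itg_integrable; apply: cont_comp => //.
  exact: separated_contr.
have I2 s x : `](t / 2), (t + 1)[%classic s -> `[0, 1]%classic x ->
    derivable (F ^~ x) s 1.
  rewrite /= in_itv/= => /andP[s1 _] _.
  have s0 : 0 < s by lra.
  by have [] := dF s x s0.
have I3 : mu.-integrable `[0, 1] (EFin \o (fun _ : R => K * B')).
  by apply: (itg_integrable 0 1); exact: cst_continuous.
have I4 s x : `](t / 2), (t + 1)[%classic s -> `[0, 1]%classic x ->
    `|partial1of2 F s x| <= K * B'.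
  rewrite /= !in_itv/= => /andP[s1 s2] x01; rewrite p1; last by lra.
  have sI : t / 2 <= s <= t + 1 by rewrite !ltW.
  rewrite normrM ler_pM//; last exact: hB'.
  by apply: hK; rewrite -ler_norml; exact: hB.
have KB0 (y : R) : 0 <= K * B' by rewrite mulr_ge0.
have D1 := @derivable_under_integral R _ _ mu F `[0, 1] (measurable_itv _) t (t / 2) (t + 1) It I1 I2 (fun=> K * B') KB0 I3 I4.
have D2 := @differentiation_under_integral R _ _ mu F `[0, 1] (measurable_itv _) t (t / 2) (t + 1) It I1 I2 (fun=> K * B') KB0 I3 I4.
apply: DeriveDef; first exact: D1.
rewrite -derive1E [LHS]D2; apply: eq_itg => x x01.
exact: p1.
Qed.

End UnderIntegral.

(** * Powers of the positive part *)

Section Truncation.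
Context {R : realType}.
Implicit Types (s x : R).

Definition pospart s : R := Num.max 0 s.

Lemma pospart_ge0 s : 0 <= pospart s.
Proof. by rewrite /pospart le_max lexx. Qed.

Lemma ge_pospart s : s <= pospart s.
Proof. by rewrite /pospart le_max lexx orbT. Qed.

Lemma pospart_pos s : 0 <= s -> pospart s = s.
Proof. by move=> s0; rewrite /pospart; apply/max_idPr. Qed.

Lemma pospart_neg s : s <= 0 -> pospart s = 0.
Proof. by move=> s0; rewrite /pospart; apply/max_idPl. Qed.

Lemma cont_pospart : continuous pospart.
Proof. by apply: cont_max; [exact: cst_continuous|move=> ?; exact: cvg_id]. Qed.

Lemma der_pospartX n s :
  is_derive s 1 (fun s => pospart s ^+ n.+2) (n.+2%:R * pospart s ^+ n.+1).
Proof.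
have [s0|s0|->] := ltgtP s 0.
- rewrite pospart_neg ?(ltW s0)// expr0n/= mulr0.
  apply: (@near_eq_is_derive _ _ _ (fun=> 0)).
  near=> y; rewrite pospart_neg ?expr0n//; apply/ltW; near: y.
  exact: lt_nbhsl.
- rewrite pospart_pos ?(ltW s0)//.
  apply: (@near_eq_is_derive _ _ _ (fun x => x ^+ n.+2)); last first.
    by rewrite -[X in is_derive _ _ _ X]mulr1; exact: (@der_exp _ _ id).
  near=> y; rewrite pospart_pos//; apply/ltW; near: y.
  exact: lt_nbhsr.
- rewrite pospart_neg// expr0n/= mulr0.
  (* At the kink the slope function is explicit, since s_+^(n+2) = s_+^(n+1) s; it is continuous and
     vanishes at 0 because the exponent n + 1 is positive. *)
  apply/is_derive1_caratheodory; exists (fun s => pospart s ^+ n.+1); split.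
  + move=> z; rewrite (pospart_neg (lexx 0)) expr0n/= !subr0.
    have [z0|/ltW z0] := leP 0 z; first by rewrite pospart_pos// -exprSr.
    by rewrite pospart_neg// !expr0n mul0r.
  + exact: (cont_exp n.+1 cont_pospart).
  + by rewrite pospart_neg// expr0n.
Unshelve. all: by end_near. Qed.

End Truncation.

(** * The maximum principle for a perturbed Burgers flow *)

Section MaximumPrinciple.
Context {R : realType} {m : nat}.
Implicit Types (t x s l z Z : R).
Context (c c' g g1 g2 : 'I_m -> R -> R) (h hx : R -> R -> R) (N r M : R).

Local Notation u := (separated c g).
Local Notation ux := (separated c g1).
Local Notation uxx := (separated c g2).
Local Notation ut := (separated c' g).

Let e t := itg 0 1 (fun x => u t x ^+ 2).
Let y t := itg 0 1 (fun x => ux t x ^+ 2).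

Context (cc : forall i, continuous (c i)) (cc' : forall i, continuous (c' i)).
Context (dc : forall i (t : R), 0 < t -> is_derive t 1 (c i) (c' i t)).
Context (dg : forall i (x : R), is_derive x 1 (g i) (g1 i x)).
Context (dg1 : forall i (x : R), is_derive x 1 (g1 i) (g2 i x)).
Context (cg2 : forall i, continuous (g2 i)).
Context (g01 : forall i, g i 1 = g i 0) (g101 : forall i, g1 i 1 = g1 i 0).
Context (dh : forall t (x : R), is_derive x 1 (h t) (hx t x)).
Context (chx : forall t, continuous (hx t)) (h01 : forall t, h t 1 = h t 0).
Context (eqn : forall t x, 0 < t -> ut t x = uxx t x - u t x * ux t x + hx t x).
Context (N1 : 1 <= N).
(** The grid enters this section through three inequalities: [h_le] is the aliasing estimate, [w_le]
    bounds the discrete transport term u_t - u_xx without any smallness, and [bernstein] is the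
    inverse inequality for polynomials of degree at most N / 2. *)
Context (h_le : forall t Z, 0 < t -> (forall x, 0 <= x <= 1 -> u t x ^+ 2 <= Z) ->
  itg 0 1 (fun x => h t x ^+ 2) <= 20 * N^-1 ^+ 2 * (Z * y t)).
Context (w_le : forall t Z, 0 < t -> (forall x, 0 <= x <= 1 -> u t x ^+ 2 <= Z) ->
  itg 0 1 (fun x => (ut t x - uxx t x) ^+ 2) <= 4 * (Z * y t)).
Context (bernstein : forall t, y t <= 16 * N ^+ 2 * e t).
Context (e0 : e 0 = r ^+ 2) (Nbig : 1440 * (r ^+ 2 + 1) <= N).
Context (M0 : forall x, 0 <= x <= 1 -> `|u 0 x| <= M).

Let cg i : continuous (g i). Proof. exact: der_cont (dg i). Qed.
Let cg1 i : continuous (g1 i). Proof. exact: der_cont (dg1 i). Qed.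
Let cu t : continuous (u t). Proof. exact: separated_contr. Qed.
Let cux t : continuous (ux t). Proof. exact: separated_contr. Qed.
Let cuxx t : continuous (uxx t). Proof. exact: separated_contr. Qed.
Let cut t : continuous (ut t). Proof. exact: separated_contr. Qed.
Let cuxt t : continuous (separated c' g1 t). Proof. exact: separated_contr. Qed.
Let ch t : continuous (h t). Proof. exact: der_cont (dh t). Qed.
Arguments chx : clear implicits.
Arguments cu : clear implicits.
Arguments cux : clear implicits.
Arguments cuxx : clear implicits.
Arguments cut : clear implicits.
Arguments cuxt : clear implicits.
Arguments ch : clear implicits.
Let du t x : is_derive x 1 (u t) (ux t x). Proof. exact: separated_deriver. Qed.
Let dux t x : is_derive x 1 (ux t) (uxx t x). Proof. exact: separated_deriver. Qed.
Let dut t x : is_derive x 1 (ut t) (separated c' g1 t x).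
Proof. exact: separated_deriver. Qed.
Let per (a b : 'I_m -> R -> R) t : (forall i, b i 1 = b i 0) ->
  separated a b t 1 = separated a b t 0.
Proof. by move=> b01; apply: eq_bigr => i _; rewrite b01. Qed.
Let u01 t : u t 1 = u t 0. Proof. exact: per. Qed.
Let ux01 t : ux t 1 = ux t 0. Proof. exact: per. Qed.
Let ut01 t : ut t 1 = ut t 0. Proof. exact: per. Qed.

Let cid : continuous (fun x : R => x). Proof. by move=> x; exact: cvg_id. Qed.

Let e_ge0 t : 0 <= e t. Proof. by apply: itg_ge0 => *; exact: sqr_ge0. Qed.
Let y_ge0 t : 0 <= y t. Proof. by apply: itg_ge0 => *; exact: sqr_ge0. Qed.

Let N0 : 0 < N. Proof. exact: lt_le_trans N1. Qed.

Let ce : continuous e.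
Proof. exact: (itg_cont cc cg (cont_exp 2 cid)). Qed.
Let cy : continuous y.
Proof. exact: (itg_cont cc cg1 (cont_exp 2 cid)). Qed.

Let dsq s : is_derive s 1 (fun s : R => s ^+ 2) (2 * s).
Proof.
have := @der_exp _ s id 1 _ (is_derive_id s 1).
by rewrite /= expr1 mulr1.
Qed.

Let c2 : continuous (fun s : R => 2 * s). Proof. exact: cont_scale. Qed.

Let de t : 0 < t -> is_derive t 1 e (itg 0 1 (fun x => 2 * u t x * ut t x)).
Proof. by move=> t0; exact: (itg_derivl cc cc' cg dc c2 dsq). Qed.

Let dy t : 0 < t -> is_derive t 1 y (itg 0 1 (fun x => 2 * ux t x * separated c' g1 t x)).
Proof. by move=> t0; exact: (itg_derivl cc cc' cg1 dc c2 dsq). Qed.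

(** Young's inequality 2 |u u_x| <= l u^2 + u_x^2 / l in the averaging bound for u^2. The parameter
    is l = N where aliasing is absorbed, and l = 1 where a bound free of N is wanted. *)
Lemma sup_sqr_le l t x : 0 < l -> 0 <= x <= 1 ->
  u t x ^+ 2 <= (1 + l) * e t + y t / l.
Proof.
move=> l0 x01.
have cd : continuous (fun x => 2 * u t x * ux t x) by apply: cont_mul => //; exact: cont_scale.
have d z : is_derive z 1 (fun x => u t x ^+ 2) (2 * u t z * ux t z).
  by have := der_exp 1 (du t z); rewrite expr1.
apply: (le_trans (sup_le_itg cd d x01)).
rewrite mulrDl mul1r -addrA lerD2l mulrC [X in _ + X]mulrC.
have cu2 := cont_exp 2 (cu t); have cux2 := cont_exp 2 (cux t).
rewrite [e t * _]mulrC -!itgZ// -itgD; [|exact: cont_scale..].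
apply: itg_le; [exact: cont_norm|by apply: cont_add; exact: cont_scale|].
move=> z _; rewrite ler_norml; apply/andP; split.
  rewrite -subr_ge0 opprK [leRHS](_ : _ = l^-1 * (l * u t z + ux t z) ^+ 2).
    by rewrite mulr_ge0 ?sqr_ge0// invr_ge0 ltW.
  by field; exact: lt0r_neq0.
rewrite -subr_ge0 [leRHS](_ : _ = l^-1 * (l * u t z - ux t z) ^+ 2).
  by rewrite mulr_ge0 ?sqr_ge0// invr_ge0 ltW.
by field; exact: lt0r_neq0.
Qed.

(** Transport integrates to zero, and h_x is moved onto u. The supremum bound with l = N together
    with [bernstein] gives u^2 <= 18 N e, hence int h^2 <= (360 e / N) y <= y / 4; this is the
    origin of 1440 = 4 * 360. Aliasing then consumes at most y of the dissipation 2 y. *)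
Let de_le t : 0 < t -> e t <= r ^+ 2 + 1 ->
  itg 0 1 (fun x => 2 * u t x * ut t x) <= - y t.
Proof.
move=> t0 et.
have Hh : itg 0 1 (fun x => h t x ^+ 2) <= y t / 4.
  have := h_le t0 (fun x => @sup_sqr_le N t x N0).
  move=> /le_trans; apply.
  have : (1 + N) * e t + y t / N <= 18 * N * e t.
    have : y t / N <= 16 * N * e t.
      by rewrite ler_pdivrMr//; apply: (le_trans (bernstein t)); lra.
    have : 0 <= (N - 1) * e t by rewrite mulr_ge0 ?subr_ge0.
    lra.
  move=> hZ.
  apply: (@le_trans _ _ (20 * N^-1 ^+ 2 * (18 * N * e t * y t))).
    apply: ler_wpM2l; first by rewrite mulr_ge0 ?sqr_ge0.
    exact: ler_wpM2r.
  have -> : 20 * N^-1 ^+ 2 * (18 * N * e t * y t) = (360 * e t / N) * y t.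
    by field; exact: lt0r_neq0.
  have : 360 * e t / N <= 4^-1.
    by rewrite ler_pdivrMr//; have := Nbig; lra.
  by have := y_ge0 t; nra.
have cu2 := cont_exp 2 (cu t); have cux2 := cont_exp 2 (cux t); have ch2 := cont_exp 2 (ch t).
have -> : itg 0 1 (fun x => 2 * u t x * ut t x) =
    2 * (itg 0 1 (fun x => uxx t x * u t x) - itg 0 1 (fun x => u t x ^+ 2 * ux t x)
      + itg 0 1 (fun x => hx t x * u t x)).
  rewrite -itgB; [|by apply: cont_mul..].
  rewrite -itgD; [|by (apply: cont_sub || idtac); apply: cont_mul..].
  rewrite -itgZ; last by apply: cont_add; [apply: cont_sub|]; apply: cont_mul.
  by apply: eq_itg => x _; rewrite eqn//; ring.
have -> : itg 0 1 (fun x => u t x ^+ 2 * ux t x) = 0.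
  have d x : is_derive x 1 (fun x => 3^-1 * u t x ^+ 3) (u t x ^+ 2 * ux t x).
    have := der_scale 3^-1 (der_exp 2 (du t x)); congr is_derive.
    by rewrite !mulrA mulVf// mul1r.
  by rewrite (itg_derive ler01 _ d) ?u01 ?subrr//; exact: cont_mul.
rewrite (itg_ibp (cuxx t) (cux t) (dux t) (du t))//.
rewrite (itg_ibp (chx t) (cux t) (dh t) (du t))//.
have -> : itg 0 1 (fun x => ux t x * ux t x) = y t by [].
have : - 2 * itg 0 1 (fun x => h t x * ux t x) <= 2^-1 * y t +
    2 * itg 0 1 (fun x => h t x ^+ 2).
  rewrite -!itgZ//; last exact: cont_mul.
  rewrite -itgD; [|exact: cont_scale..].
  apply: itg_le; [by apply: cont_scale; exact: cont_mul|by apply: cont_add; exact: cont_scale|].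
  move=> x _; have := sqr_ge0 (ux t x + 2 * h t x); nra.
by move: Hh; lra.
Qed.

(* e(t) cannot jump across the window [r^2, r^2 + 1], where it decreases: the
   truncation zeta(e) with zeta(s) = - ((r^2 + 1 - s)_+)^2 is nonincreasing for all times. *)
Let e_le t : 0 <= t -> e t <= r ^+ 2.
Proof.
pose K := r ^+ 2 + 1.
have dz s : 0 < s -> is_derive s 1 (fun s => -1 * pospart (K - e s) ^+ 2)
   (-1 * (2 * pospart (K - e s) * (0 - itg 0 1 (fun x => 2 * u s x * ut s x)))).
  move=> s0; apply: der_scale.
  have := @der_pospartX _ 0 (K - e s); rewrite expr1 => dp.
  apply: (@der_comp _ _ (fun s => pospart s ^+ 2) (fun s => K - e s)) => //.
  by apply: der_sub; exact: de.
move=> t0.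
have cz : continuous (fun s => -1 * pospart (K - e s) ^+ 2).
  apply: cont_scale; apply: cont_exp; apply: (@cont_comp _ pospart); last exact: cont_pospart.
  by apply: cont_sub => //; exact: cst_continuous.
have := nonincreasing_from0 cz dz _ t0.
rewrite e0 (_ : K - r ^+ 2 = 1) ?(@pospart_pos _ 1)//; last by rewrite /K; ring.
move=> H.
have {H} : -1 * pospart (K - e t) ^+ 2 <= -1 * 1 ^+ 2.
  apply: H => s s0; have [eK|eK] := leP (e s) K; last first.
    by rewrite pospart_neg ?mulr0 ?mul0r ?mulr0//; rewrite subr_le0 ltW.
  have := de_le s0 eK; have := y_ge0 s; have := pospart_ge0 (K - e s); nra.
have [eK|eK] := leP (e t) K; last first.
  by rewrite pospart_neg; [rewrite expr0n/=; lra|rewrite subr_le0 ltW].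
by rewrite pospart_pos; [move: eK; rewrite /K; nra|rewrite subr_ge0].
Qed.

Let de_ley t : 0 < t -> itg 0 1 (fun x => 2 * u t x * ut t x) <= - y t.
Proof.
move=> t0; apply: de_le => //.
by apply: (le_trans (e_le (ltW t0))); lra.
Qed.

Let u2_le t x : 0 <= t -> 0 <= x <= 1 -> u t x ^+ 2 <= 2 * r ^+ 2 + y t.
Proof.
move=> t0 x01; apply: (le_trans (@sup_sqr_le 1 t x ltr01 x01)).
by have := e_le t0; lra.
Qed.

(** After one integration by parts the integrand is -2 u_t u_xx = ((u_t - u_xx)^2 - (u_t + u_xx)^2)
    / 2, so [w_le] suffices and no bound on h_x is called for. *)
Let dy_le t : 0 < t ->
  itg 0 1 (fun x => 2 * ux t x * separated c' g1 t x) <= 2 * ((2 * r ^+ 2 + y t) * y t).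
Proof.
move=> t0.
have -> : itg 0 1 (fun x => 2 * ux t x * separated c' g1 t x) =
    2 * itg 0 1 (fun x => separated c' g1 t x * ux t x).
  rewrite -itgZ; last exact: cont_mul.
  by apply: eq_itg => x _; ring.
rewrite (itg_ibp (cuxt t) (cuxx t) (dut t) (dux t))//.
have Hw := w_le t0 (fun x => @u2_le t x (ltW t0)).
have cw : continuous (fun x => ut t x - uxx t x) by exact: cont_sub.
have cw2 := cont_exp 2 cw.
suff : 2 * - itg 0 1 (fun x => ut t x * uxx t x) <=
  2^-1 * itg 0 1 (fun x => (ut t x - uxx t x) ^+ 2) by lra.
rewrite mulrN -mulNr -!itgZ//; last exact: cont_mul.
apply: itg_le; [by apply: cont_scale; exact: cont_mul|exact: cont_scale|].
move=> x _; have := sqr_ge0 (uxx t x); have := sqr_ge0 (ut t x + uxx t x); nra.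
Qed.

(** The value at time 0 of (1 + y) exp(C e) with C = 4 r^2 + 2, where e = r^2, as a function of the
    initial y. *)
Definition gradient_bound (y0 : R) := expR ((4 * r ^+ 2 + 2) * r ^+ 2) * (1 + y0).

Let Y := gradient_bound (y 0).

(** The bound y' <= 2 (2 r^2 + y) y alone would allow blow-up, but e' <= - y pays for one factor y:
    C = 4 r^2 + 2 is chosen so that 2 (2 r^2 + y) <= C (1 + y). *)
Let y_le t : 0 <= t -> y t <= Y.
Proof.
pose C := 4 * r ^+ 2 + 2.
have C0 : 0 <= C by have := sqr_ge0 r; rewrite /C; lra.
pose F s := (1 + y s) * expR (C * e s).
pose dF s := (0 + itg 0 1 (fun x => 2 * ux s x * separated c' g1 s x)) * expR (C * e s) +
  (1 + y s) * (expR (C * e s) * (C * itg 0 1 (fun x => 2 * u s x * ut s x))).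
have dF' s : 0 < s -> is_derive s 1 F (dF s).
  move=> s0; apply: der_mul.
    by apply: der_add; exact: dy.
  apply: (@der_comp _ _ expR (fun s => C * e s)).
  by apply: der_scale; exact: de.
have cF : continuous F.
  apply: cont_mul; first by apply: cont_add => //; exact: cst_continuous.
  apply: (@cont_comp _ expR); last exact: continuous_expR.
  exact: cont_scale.
move=> t0; have := nonincreasing_from0 cF dF' _ t0.
rewrite /F e0 => H.
have {H} : (1 + y t) * expR (C * e t) <= (1 + y 0) * expR (C * r ^+ 2).
  apply: H.
  move=> s s0; rewrite /dF add0r.
  have := dy_le s0; have := de_ley s0; have := expR_gt0 (C * e s); have := y_ge0 s.
  set E := expR _; set a := itg _ _ _; set b := itg _ _ _ => ys E0 ab bb.
  rewrite [leLHS](_ : _ = E * (b + (1 + y s) * C * a)); last by ring.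
  rewrite pmulr_rle0//.
  have : (1 + y s) * C * a <= (1 + y s) * C * - y s.
    by rewrite ler_wpM2l// mulr_ge0//; lra.
  by move: bb; rewrite /C; have := sqr_ge0 r; nra.
rewrite -/C => H; rewrite /Y /gradient_bound -/C [leRHS]mulrC.
apply: le_trans H.
have : 1 <= expR (C * e t) by rewrite -expR0 ler_expR mulr_ge0.
by have := y_ge0 t; nra.
Qed.

Let Y0 : 0 <= Y. Proof. exact: le_trans (y_ge0 0) (y_le (lexx 0)). Qed.

(** Divided by N, this is the eventual bound for sup p^2. In the first term 180 = 3 * 3 * 20, with
    20 from [h_le], one 3 from [dJ_le] and the other from the multiple 3 N J in [p4_le]; the second
    term is the gradient part of [p4_le]. *)
Definition overshoot (y0 : R) := 180 * (2 * r ^+ 2 + gradient_bound y0) * r ^+ 2 +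
  2 * gradient_bound y0.

(** * The excess of s u over M for a sign s *)

Section OneSide.
Context (s : R) (s2 : s ^+ 2 = 1).

Let p t x := pospart (s * u t x - M).
Let cp t : continuous (p t).
Proof.
apply: (@cont_comp _ pospart); last exact: cont_pospart.
by apply: cont_sub; [exact: cont_scale|exact: cst_continuous].
Qed.
Arguments cp : clear implicits.
Let p_ge0 t x : 0 <= p t x. Proof. exact: pospart_ge0. Qed.
Let p01 t : p t 1 = p t 0. Proof. by rewrite /p u01. Qed.

Let dp n t x : is_derive x 1 (fun x => p t x ^+ n.+2)
  (n.+2%:R * p t x ^+ n.+1 * (s * ux t x)).
Proof.
apply: (@der_comp _ _ (fun z => pospart z ^+ n.+2) (fun x => s * u t x - M)).
  exact: der_pospartX.
rewrite -[s * ux t x]subr0; apply: der_sub; exact: der_scale.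
Qed.

Let J t := itg 0 1 (fun x => p t x ^+ 4).
Let psi z := 4 * pospart (s * z - M) ^+ 3 * s.

Let claff : continuous (fun z => s * z - M).
Proof. by apply: cont_sub; [exact: cont_scale|exact: cst_continuous]. Qed.

Let dPsi z : is_derive z 1 (fun z => pospart (s * z - M) ^+ 4) (psi z).
Proof.
apply: (@der_comp _ _ (fun z => pospart z ^+ 4) (fun z => s * z - M)).
  exact: der_pospartX.
rewrite -[X in is_derive _ _ _ X]subr0; apply: der_sub.
by rewrite -[X in is_derive _ _ _ X]mulr1; apply: der_scale.
Qed.

Let cpsi : continuous psi.
Proof.
apply: cont_mul; last exact: cst_continuous.
by apply: cont_scale; apply: cont_exp; apply: cont_comp => //; exact: cont_pospart.
Qed.

Let dJ t : 0 < t -> is_derive t 1 J (itg 0 1 (fun x => psi (u t x) * ut t x)).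
Proof. by move=> t0; exact: (itg_derivl cc cc' cg dc cpsi dPsi). Qed.

Let cJ : continuous J.
Proof.
apply: (itg_cont (Psi := fun z => pospart (s * z - M) ^+ 4) cc cg).
by apply: cont_exp; apply: cont_comp => //; exact: cont_pospart.
Qed.

(** Against the test function s p^3, diffusion yields - 12 p^2 u_x^2 and aliasing - 12 p^2 h u_x;
    completing the square leaves 3 p^2 h^2. *)
Let dJ_le t Z : 0 < t -> (forall x, 0 <= x <= 1 -> p t x ^+ 2 <= Z) ->
  itg 0 1 (fun x => psi (u t x) * ut t x) <= 3 * Z * itg 0 1 (fun x => h t x ^+ 2).
Proof.
move=> t0 pZ.
pose G x := s * p t x ^+ 3.
pose gG x := s * (3 * p t x ^+ 2 * (s * ux t x)).
have dG x : is_derive x 1 G (gG x) by apply: der_scale; exact: dp.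
have cp2 := cont_exp 2 (cp t); have cp3 := cont_exp 3 (cp t); have cp4 := cont_exp 4 (cp t).
have cG : continuous G by exact: cont_scale.
have cgG : continuous gG.
  by apply: cont_scale; apply: cont_mul; [exact: cont_scale|exact: cont_scale].
have G01 : G 1 = G 0 by rewrite /G p01.
have -> : itg 0 1 (fun x => psi (u t x) * ut t x) =
    4 * (itg 0 1 (fun x => uxx t x * G x) - itg 0 1 (fun x => G x * u t x * ux t x)
      + itg 0 1 (fun x => hx t x * G x)).
  have c1 : continuous (fun x => uxx t x * G x) by exact: cont_mul.
  have c3 : continuous (fun x => hx t x * G x) by exact: cont_mul.
  have c4 : continuous (fun x => G x * u t x * ux t x).
    by apply: cont_mul => //; exact: cont_mul.
  rewrite -itgB// -itgD//; last exact: cont_sub.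
  rewrite -itgZ; last by apply: cont_add => //; exact: cont_sub.
  by apply: eq_itg => x _; rewrite eqn// /psi /G /p; ring.
have -> : itg 0 1 (fun x => G x * u t x * ux t x) = 0.
  (* Where p > 0 one has s u = p + M, so the transport term is p^3 (p + M) u_x, an exact derivative;
     elsewhere both sides vanish. *)
  pose F x := s * (5^-1 * p t x ^+ 5 + M * 4^-1 * p t x ^+ 4).
  have d x : is_derive x 1 F (G x * u t x * ux t x).
    have := der_scale s (der_add (der_scale 5^-1 (dp 3 t x)) (der_scale (M * 4^-1) (dp 2 t x))).
    congr is_derive.
    have -> : s * (5^-1 * (5 * p t x ^+ 4 * (s * ux t x)) +
      M / 4 * (4 * p t x ^+ 3 * (s * ux t x))) =
      s ^+ 2 * (p t x ^+ 3 * (p t x + M)) * ux t x by field.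
    rewrite s2 mul1r /G /p; have [a0|/ltW a0] := leP 0 (s * u t x - M).
      by rewrite pospart_pos//; ring.
    by rewrite pospart_neg//; ring.
  rewrite (itg_derive ler01 _ d); first by rewrite /F p01 subrr.
  by apply: cont_mul => //; exact: cont_mul.
rewrite (itg_ibp (cuxx t) cgG (dux t) dG)//.
rewrite (itg_ibp (chx t) cgG (dh t) dG)//.
have c1 : continuous (fun x => ux t x * gG x) by exact: cont_mul.
have c3 : continuous (fun x => h t x * gG x) by exact: cont_mul.
have ch2 := cont_exp 2 (ch t).
rewrite subr0 mulrDr !mulrN -!mulNr -!itgZ// -itgD; [|exact: cont_scale..].
apply: itg_le; [by apply: cont_add; exact: cont_scale|exact: cont_scale|].
move=> x x01; rewrite /gG.
rewrite [leLHS](_ : _ = s ^+ 2 * (- 12 * p t x ^+ 2 * (ux t x ^+ 2 + h t x * ux t x)));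
  last by ring.
rewrite s2 mul1r.
apply: (@le_trans _ _ (3 * p t x ^+ 2 * h t x ^+ 2)).
  rewrite -subr_ge0 [leRHS](_ : _ = 3 * p t x ^+ 2 * (h t x + 2 * ux t x) ^+ 2).
    by apply: mulr_ge0; [apply: mulr_ge0|]; rewrite ?sqr_ge0.
  by ring.
by rewrite ler_wpM2r ?sqr_ge0// ler_wpM2l// pZ.
Qed.

Let p0 x : 0 <= x <= 1 -> p 0 x = 0.
Proof.
move=> x01; rewrite /p pospart_neg// subr_le0.
apply: (le_trans (ler_norm _)); rewrite normrM.
have -> : `|s| = 1.
  by apply/eqP; rewrite -(@pexpr_eq1 _ _ 2)// -normrX s2 normr1.
by rewrite mul1r; exact: M0.
Qed.

(** J starts at 0 and grows at a rate of at most k y, while e decreases at a rate of at least y. So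
    J + k e is nonincreasing, and J stays below k e(0) for all times. *)
Let J_le t Z : 0 <= Z -> 0 <= t ->
  (forall t x, 0 <= t -> 0 <= x <= 1 -> p t x ^+ 2 <= Z) ->
  J t <= 60 * Z * N^-1 ^+ 2 * (2 * r ^+ 2 + Y) * r ^+ 2.
Proof.
move=> Z0 t0 pZ; set k := _ * (2 * r ^+ 2 + Y).
have k0 : 0 <= k.
  rewrite /k mulr_ge0//; last by have := Y0; have := sqr_ge0 r; lra.
  by apply: mulr_ge0; [exact: mulr_ge0|exact: sqr_ge0].
have J0 : J 0 = 0.
  rewrite /J -[RHS](mul0r (1 - 0)) -itg_cst//; apply: eq_itg => x x01.
  by rewrite p0// expr0n.
have dF z : 0 < z -> is_derive z 1 (fun z => J z + k * e z)
   (itg 0 1 (fun x => psi (u z x) * ut z x) + k * itg 0 1 (fun x => 2 * u z x * ut z x)).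
  by move=> z0; apply: der_add; [exact: dJ|apply: der_scale; exact: de].
have cF : continuous (fun z => J z + k * e z) by apply: cont_add => //; exact: cont_scale.
have := nonincreasing_from0 cF dF _ t0; rewrite J0 e0 add0r => H.
have {H} : J t + k * e t <= k * r ^+ 2.
  apply: H => z z0.
  have := dJ_le z0 (fun x => pZ z x (ltW z0)).
  have := h_le z0 (fun x => @u2_le z x (ltW z0)).
  set H := itg _ _ _ => Hle; set a := itg _ _ _ => ale.
  have b := de_ley z0; have yz := y_ge0 z; have yY := y_le (ltW z0).
  have r0 := sqr_ge0 r.
  have h1 : H <= 20 * N^-1 ^+ 2 * ((2 * r ^+ 2 + Y) * y z).
    apply: (le_trans Hle); apply: ler_wpM2l; first by rewrite mulr_ge0 ?sqr_ge0.
    by apply: ler_wpM2r => //; lra.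
  have h2 : 3 * Z * H <= k * y z.
    have -> : k * y z = 3 * Z * (20 * N^-1 ^+ 2 * ((2 * r ^+ 2 + Y) * y z)).
      by rewrite /k; ring.
    by rewrite ler_wpM2l// mulr_ge0.
  have := ler_wpM2l k0 b; lra.
by have := e_ge0 t; nra.
Qed.

(** In the averaging bound for p^4, Young's inequality 4 p^3 |u_x| <= 2 N p^4 + 2 p^2 u_x^2 / N
    carries the weight N because J is of order Z N^-2 and int u_x^2 of order 1; both terms come out
    of order Z / N. *)
Let p4_le t x Z : 0 <= Z -> 0 <= t -> 0 <= x <= 1 ->
  (forall t x, 0 <= t -> 0 <= x <= 1 -> p t x ^+ 2 <= Z) ->
  p t x ^+ 4 <= Z * (overshoot (y 0) / N).
Proof.
move=> Z0 t0 x01 pZ.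
have cd : continuous (fun x => 4 * p t x ^+ 3 * (s * ux t x)).
  by apply: cont_mul; apply: cont_scale => //; exact: cont_exp.
apply: (le_trans (sup_le_itg cd (fun z => dp 2 t z) x01)); rewrite -/(J t).
have h1 : itg 0 1 (fun x => `|4 * p t x ^+ 3 * (s * ux t x)|) <=
    2 * N * J t + 2 * Z / N * y t.
  have cp4 := cont_exp 4 (cp t); have cux2 := cont_exp 2 (cux t).
  rewrite -!itgZ// -itgD; [|exact: cont_scale..].
  apply: itg_le; [exact: cont_norm|by apply: cont_add; exact: cont_scale|].
  move=> z z01.
  have key : 0 <= (Z - p t z ^+ 2) * ux t z ^+ 2 by rewrite mulr_ge0 ?sqr_ge0 ?subr_ge0 ?pZ.
  have bound b : b ^+ 2 = 1 -> b * (4 * p t z ^+ 3 * (s * ux t z)) <=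
      2 * N * p t z ^+ 4 + 2 * Z / N * ux t z ^+ 2.
    move=> b2.
    apply: (@le_trans _ _ (2 * N * p t z ^+ 4 + 2 * p t z ^+ 2 / N * ux t z ^+ 2)).
      rewrite -subr_ge0 [leRHS](_ : _ =
         2 * p t z ^+ 2 / N * ((N * p t z - b * s * ux t z) ^+ 2 +
           (1 - b ^+ 2 * s ^+ 2) * ux t z ^+ 2)); last first.
        by field; exact: lt0r_neq0.
      rewrite b2 s2 mul1r subrr mul0r addr0; apply: mulr_ge0; last exact: sqr_ge0.
      by apply: divr_ge0; [apply: mulr_ge0; rewrite ?sqr_ge0|exact: ltW].
    rewrite lerD2l; have -> : 2 * Z / N * ux t z ^+ 2 = 2 / N * (Z * ux t z ^+ 2) by ring.
    have -> : 2 * p t z ^+ 2 / N * ux t z ^+ 2 = 2 / N * (p t z ^+ 2 * ux t z ^+ 2) by ring.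
    apply: ler_wpM2l; last by move: key; rewrite mulrBl subr_ge0.
    by apply: divr_ge0 => //; exact: ltW.
  rewrite ler_norml; apply/andP; split; last first.
    by rewrite -[leLHS]mul1r; apply: bound; rewrite expr1n.
  by rewrite lerNl -mulN1r; apply: bound; rewrite sqrrN expr1n.
have h2 := J_le Z0 t0 pZ; have h3 := y_le t0.
have J0 : 0 <= J t by apply: itg_ge0 => z _; rewrite exprn_ge0.
apply: (@le_trans _ _ (3 * N * J t + 2 * Z / N * Y)).
  have : J t <= N * J t by rewrite ler_peMl.
  have : 2 * Z / N * y t <= 2 * Z / N * Y.
    by apply: ler_wpM2l => //; apply: divr_ge0; [exact: mulr_ge0|exact: ltW].
  by move: h1; lra.
have : 3 * N * J t <= 3 * N * (60 * Z * N^-1 ^+ 2 * (2 * r ^+ 2 + Y) * r ^+ 2).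
  by rewrite ler_wpM2l// mulr_ge0// ltW.
rewrite /overshoot -/Y.
have -> : 3 * N * (60 * Z * N^-1 ^+ 2 * (2 * r ^+ 2 + Y) * r ^+ 2) =
  Z * (180 * (2 * r ^+ 2 + Y) * r ^+ 2 / N).
  by field; exact: lt0r_neq0.
by rewrite mulrDl mulrDr; lra.
Qed.

(** The supremum Z of p^2 over all times and points is finite by the uniform gradient bound, so it
    may serve as its own a priori bound: p^4 <= Z k everywhere gives Z^2 <= Z k, hence Z <= k. *)
Lemma one_sided_le t x : 0 <= t -> 0 <= x <= 1 ->
  s * u t x <= M + Num.sqrt (overshoot (y 0) / N).
Proof.
set k := overshoot _ / _ => t0 x01.
have k0 : 0 <= k.
  rewrite /k /overshoot -/Y divr_ge0 ?(ltW N0)//.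
  by have := sqr_ge0 r; have := Y0; nra.
pose P := [set q | exists t x, [/\ 0 <= t, 0 <= x <= 1 & q = p t x ^+ 2]].
have hP : has_sup P.
  split; first by exists (p 0 0 ^+ 2), 0, 0; rewrite lexx ler01.
  exists (2 * (2 * r ^+ 2 + Y) + 2 * M ^+ 2) => _ [t1 [x1 [t10 x10 ->]]].
  have h1 := u2_le t10 x10; have h2 := y_le t10.
  have su2 : (s * u t1 x1) ^+ 2 = u t1 x1 ^+ 2 by rewrite exprMn s2 mul1r.
  have [a0|/ltW a0] := leP 0 (s * u t1 x1 - M).
    rewrite /p pospart_pos//.
    by have := sqr_ge0 (s * u t1 x1 + M); lra.
  rewrite /p pospart_neg// expr0n/=.
  by have := sqr_ge0 M; have := sqr_ge0 (u t1 x1); lra.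
pose Z := sup P.
have pZ t1 x1 : 0 <= t1 -> 0 <= x1 <= 1 -> p t1 x1 ^+ 2 <= Z.
  by move=> t10 x10; apply: sup_upper_bound => //; exists t1, x1.
have Z0 : 0 <= Z by apply: le_trans (pZ _ _ t0 x01); exact: sqr_ge0.
have Zk : Z <= Num.sqrt (Z * k).
  apply: sup_le_ub; first by case: hP.
  move=> _ [t1 [x1 [t10 x10 ->]]].
  rewrite -(ler_pXn2r (n := 2)) ?nnegrE ?sqr_ge0 ?sqrtr_ge0//.
  rewrite sqr_sqrtr; [|exact: mulr_ge0]. rewrite -exprM; exact: p4_le.
have {}Zk : Z <= k.
  have [->//|Zn0] := eqVneq Z 0; have {}Z0 : 0 < Z by rewrite lt0r Zn0.
  rewrite -(ler_pM2l Z0) -expr2.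
  by rewrite -[leRHS](sqr_sqrtr (mulr_ge0 (ltW Z0) k0)) ler_sqr ?nnegrE ?sqrtr_ge0// ltW.
rewrite -lerBlDl; apply: (le_trans (ge_pospart _)).
rewrite -(ler_pXn2r (n := 2)) ?nnegrE ?pospart_ge0 ?sqrtr_ge0//.
by rewrite sqr_sqrtr// (le_trans (pZ _ _ t0 x01)).
Qed.

End OneSide.

Lemma effective_maximum_principle t x : 0 <= t -> 0 <= x <= 1 ->
  `|u t x| <= M + Num.sqrt (overshoot (y 0) / N).
Proof.
move=> t0 x01; rewrite ler_norml lerNl -mulN1r -[X in _ && (X <= _)]mul1r.
by rewrite !one_sided_le ?sqrrN ?expr1n.
Qed.

End MaximumPrinciple.

(** * Trigonometric polynomials *)

Section Trig.
Context {R : realType}.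
Implicit Types (x y t : R) (a b c d : nat -> R) (k l m r : nat).

Definition tau k : R := 2 * pi * k%:R.

(** The modes run over k < m: degree n is [trig n.+1], and [trig n] is the same polynomial without
    its mode n. *)
Definition trig m a b x : R :=
  \sum_(k < m) (a k * cos (tau k * x) + b k * sin (tau k * x)).

Lemma der_linear t x : is_derive x 1 (fun x => t * x) t.
Proof. by rewrite -[X in is_derive _ _ _ X]mulr1; exact: der_scale. Qed.

Lemma der_cosl t x : is_derive x 1 (fun x => cos (t * x)) (- t * sin (t * x)).
Proof. by rewrite mulNr mulrC -mulNr; apply: (@der_comp _ _ cos); exact: der_linear. Qed.

Lemma der_sinl t x : is_derive x 1 (fun x => sin (t * x)) (t * cos (t * x)).
Proof. by rewrite mulrC; apply: (@der_comp _ _ sin); exact: der_linear. Qed.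

Lemma cont_cosl t : continuous (fun x => cos (t * x)).
Proof. exact: der_cont (der_cosl t). Qed.

Lemma cont_sinl t : continuous (fun x => sin (t * x)).
Proof. exact: der_cont (der_sinl t). Qed.

Arguments cont_cosl : clear implicits.
Arguments cont_sinl : clear implicits.

Lemma der_trig m a b x : is_derive x 1 (trig m a b)
  (trig m (fun k => tau k * b k) (fun k => - (tau k * a k)) x).
Proof.
apply: der_sum => k.
have := der_add (der_scale (a k) (der_cosl (tau k) x)) (der_scale (b k) (der_sinl (tau k) x)).
congr is_derive; ring.
Qed.

Lemma cont_trig m a b : continuous (trig m a b).
Proof. exact: der_cont (der_trig m a b). Qed.

Lemma sin_tau1 k : sin (tau k) = 0.
Proof.
rewrite /tau; elim: k => [|k IH]; first by rewrite mulr0 sin0.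
by rewrite -[k.+1%:R]natr1 mulrDr mulr1 [X in _ + X]mulr_natl sinD2pi.
Qed.

Lemma cos_tau1 k : cos (tau k) = 1.
Proof.
rewrite /tau; elim: k => [|k IH]; first by rewrite mulr0 cos0.
by rewrite -[k.+1%:R]natr1 mulrDr mulr1 [X in _ + X]mulr_natl cosD2pi.
Qed.

Lemma trig01 m a b : trig m a b 1 = trig m a b 0.
Proof.
by rewrite /trig; apply: eq_bigr => k _; rewrite mulr1 mulr0 cos_tau1 sin_tau1 cos0 sin0.
Qed.

Lemma trig_periodic m a b x : trig m a b (x + 1) = trig m a b x.
Proof.
rewrite /trig; apply: eq_bigr => k _.
by rewrite mulrDr mulr1 cosD sinD cos_tau1 sin_tau1 !mulr1 !mulr0 subr0 addr0.
Qed.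

Lemma itg_cos k : itg 0 1 (fun x => cos (tau k * x)) = (k == 0)%:R.
Proof.
have [->|k0] := eqVneq k 0%N.
  rewrite -[RHS]mul1r -[X in _ * X](subr0 1) -itg_cst//; apply: eq_itg => x _.
  by rewrite /tau mulr0 mul0r cos0.
have t0 : tau k != 0.
  by rewrite /tau !mulf_neq0// ?pnatr_eq0//; exact/lt0r_neq0/pi_gt0.
have dF x : is_derive x 1 (fun x => (tau k)^-1 * sin (tau k * x)) (cos (tau k * x)).
  have := der_scale (tau k)^-1 (der_sinl (tau k) x).
  by rewrite mulKf.
rewrite (itg_derive ler01 (cont_cosl _) dF) mulr1 mulr0 sin_tau1 sin0.
by rewrite !mulr0 subr0.
Qed.

Lemma itg_sin k : itg 0 1 (fun x => sin (tau k * x)) = 0.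
Proof.
have [->|k0] := eqVneq k 0%N.
  rewrite -[RHS](mul0r (1 - 0)) -itg_cst//; apply: eq_itg => x _.
  by rewrite /tau mulr0 mul0r sin0.
have t0 : tau k != 0.
  by rewrite /tau !mulf_neq0// ?pnatr_eq0//; exact/lt0r_neq0/pi_gt0.
have dF x : is_derive x 1 (fun x => - (tau k)^-1 * cos (tau k * x)) (sin (tau k * x)).
  have := der_scale (- (tau k)^-1) (der_cosl (tau k) x).
  by rewrite mulrA mulrNN mulVf// mul1r.
rewrite (itg_derive ler01 (cont_sinl _) dF) mulr1 mulr0 cos_tau1 cos0.
by rewrite !mulr1 subrr.
Qed.

(* Serves both for the integral over [0, 1] and for the average over the grid:
   these differ only in the mean of cos (tau n.*2 x), which is 0 resp. 1. *)
Section Pairing.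
Context (E : (R -> R) -> R) (n : nat).
Context (ED : forall f g : R -> R, continuous f -> continuous g ->
  E (fun x => f x + g x) = E f + E g).
Context (EZ : forall (z : R) (f : R -> R), continuous f -> E (fun x => z * f x) = z * E f).
Context (E1 : E (fun x => cos (tau 0 * x)) = 1).
Context (Ecos : forall r, (0 < r < n.*2)%N -> E (fun x => cos (tau r * x)) = 0).
Context (Esin : forall r, (r <= n.*2)%N -> E (fun x => sin (tau r * x)) = 0).

Let tauD k l : tau (k + l) = tau k + tau l.
Proof. by rewrite /tau natrD mulrDr. Qed.

Let Esum m (F : 'I_m -> R -> R) : (forall i, continuous (F i)) ->
  E (fun x => \sum_i F i x) = \sum_i E (F i).
Proof.
elim: m F => [|m IH] F cF.
  rewrite big_ord0 (_ : (fun x => _) = (fun x => 0 * 0)).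
    by rewrite (@EZ 0 (fun=> 0)) ?mul0r//; exact: cst_continuous.
  by apply/funext => x; rewrite big_ord0 mul0r.
rewrite big_ord_recl -IH// -ED//; last exact: cont_sum.
by congr E; apply/funext => x; rewrite big_ord_recl.
Qed.

(** By the double-angle formula these are the mean squares of cos(tau k x) and sin(tau k x) under
    [E]. *)
Definition cos_weight k := 2^-1 * (1 + E (fun x => cos (tau k.*2 * x))).
Definition sin_weight k := 2^-1 * (1 - E (fun x => cos (tau k.*2 * x))).

Let Eeq f g : f =1 g -> E f = E g. Proof. by move=> fg; congr E; exact/funext. Qed.

Let cc k : continuous (fun x => cos (tau k * x)). Proof. exact: cont_cosl. Qed.
Let cs k : continuous (fun x => sin (tau k * x)). Proof. exact: cont_sinl. Qed.
Arguments cc : clear implicits.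
Arguments cs : clear implicits.

(** Writing k = l + r turns the product into half the sum of the modes r and k + l. For r > 0 both
    lie strictly between 0 and 2 n and have mean zero; for r = 0 the mode 2 k remains, which is what
    the weight records. *)
Lemma mean_cos_cos k l : (k <= n)%N -> (l <= n)%N ->
  E (fun x => cos (tau k * x) * cos (tau l * x)) = (k == l)%:R * cos_weight k.
Proof.
wlog lk : k l / (l <= k)%N => [H|] kn ln.
  have [lk|/ltnW kl] := leqP l k; first exact: H.
  rewrite (eq_sym k) (_ : _ * cos_weight k = (l == k)%:R * cos_weight l).
    by rewrite -H//; apply: Eeq => x; rewrite mulrC.
  by case: eqP => [->//|_]; rewrite !mul0r.
have [r kE] : exists r, k = (l + r)%N by exists (k - l)%N; rewrite subnKC.
have -> : E (fun x => cos (tau k * x) * cos (tau l * x)) =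
  2^-1 * (E (fun x => cos (tau r * x)) + E (fun x => cos (tau (k + l) * x))).
  rewrite -ED// -EZ; last exact: cont_add.
  apply: Eeq => x; rewrite kE !tauD !mulrDl.
  rewrite !cosD !sinD.
  set a := cos _; set b := cos _; set c := sin _; set d := sin _.
  have h : a ^+ 2 = 1 - c ^+ 2 by rewrite /a cos2sin2.
  have : a * (a * b) = (1 - c ^+ 2) * b by rewrite mulrA -expr2 h.
  nra.
case: (posnP r) kE => [->|r0] kE.
  rewrite addn0 in kE; rewrite -kE eqxx mul1r E1 /cos_weight.
  by rewrite addnn.
rewrite !Ecos; [|lia..].
by rewrite addr0 mulr0 kE (_ : _ == _ = false) ?mul0r//; lia.
Qed.

Lemma mean_sin_sin k l : (k <= n)%N -> (l <= n)%N ->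
  E (fun x => sin (tau k * x) * sin (tau l * x)) = (k == l)%:R * sin_weight k.
Proof.
wlog lk : k l / (l <= k)%N => [H|] kn ln.
  have [lk|/ltnW kl] := leqP l k; first exact: H.
  rewrite (eq_sym k) (_ : _ * sin_weight k = (l == k)%:R * sin_weight l).
    by rewrite -H//; apply: Eeq => x; rewrite mulrC.
  by case: eqP => [->//|_]; rewrite !mul0r.
have [r kE] : exists r, k = (l + r)%N by exists (k - l)%N; rewrite subnKC.
have -> : E (fun x => sin (tau k * x) * sin (tau l * x)) =
  2^-1 * (E (fun x => cos (tau r * x)) + -1 * E (fun x => cos (tau (k + l) * x))).
  rewrite -EZ// -ED//; last exact: cont_scale.
  rewrite -EZ; last by apply: cont_add => //; exact: cont_scale.
  apply: Eeq => x; rewrite kE !tauD !mulrDl.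
  rewrite !cosD !sinD.
  set a := cos (tau l * x); set b := cos (tau r * x).
  set c := sin (tau l * x); set d := sin (tau r * x).
  have h : a ^+ 2 = 1 - c ^+ 2 by rewrite /a cos2sin2.
  have : a * (a * b) = (1 - c ^+ 2) * b by rewrite mulrA -expr2 h.
  nra.
case: (posnP r) kE => [->|r0] kE.
  rewrite addn0 in kE; rewrite -kE eqxx mul1r E1 /sin_weight mulN1r.
  by rewrite addnn.
rewrite !Ecos; [|lia..].
by rewrite mulr0 addr0 mulr0 kE (_ : _ == _ = false) ?mul0r//; lia.
Qed.

Lemma mean_cos_sin k l : (k <= n)%N -> (l <= n)%N ->
  E (fun x => cos (tau k * x) * sin (tau l * x)) = 0.
Proof.
move=> kn ln; have [lk|/ltnW kl] := leqP l k.
  have [r kE] : exists r, k = (l + r)%N by exists (k - l)%N; rewrite subnKC.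
  have -> : E (fun x => cos (tau k * x) * sin (tau l * x)) =
      2^-1 * (E (fun x => sin (tau (k + l) * x)) + -1 * E (fun x => sin (tau r * x))).
    rewrite -EZ// -ED//; last exact: cont_scale.
    rewrite -EZ; last by apply: cont_add => //; exact: cont_scale.
    apply: Eeq => x; rewrite kE !tauD !mulrDl !sinD !cosD.
    set a := cos (tau l * x); set b := cos (tau r * x).
  set c := sin (tau l * x); set d := sin (tau r * x).
    have h : a ^+ 2 = 1 - c ^+ 2 by rewrite /a cos2sin2.
    have : a * (a * d) = (1 - c ^+ 2) * d by rewrite mulrA -expr2 h.
    nra.
  by rewrite !Esin ?mulr0 ?addr0 ?mulr0//; lia.
have [r lE] : exists r, l = (k + r)%N by exists (l - k)%N; rewrite subnKC.
have -> : E (fun x => cos (tau k * x) * sin (tau l * x)) =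
    2^-1 * (E (fun x => sin (tau (k + l) * x)) + E (fun x => sin (tau r * x))).
  rewrite -ED// -EZ; last exact: cont_add.
  apply: Eeq => x; rewrite lE !tauD !mulrDl !sinD !cosD.
  set a := cos (tau k * x); set b := cos (tau r * x).
  set c := sin (tau k * x); set d := sin (tau r * x).
  have h : a ^+ 2 = 1 - c ^+ 2 by rewrite /a cos2sin2.
  have : a * (a * d) = (1 - c ^+ 2) * d by rewrite mulrA -expr2 h.
  nra.
by rewrite !Esin ?addr0 ?mulr0//; lia.
Qed.

Lemma mean_trig_cos a b l : (l <= n)%N ->
  E (fun x => trig n.+1 a b x * cos (tau l * x)) = cos_weight l * a l.
Proof.
move=> ln.
have cF (k : 'I_n.+1) : continuous (fun x =>
    a k * (cos (tau k * x) * cos (tau l * x)) + b k * (cos (tau l * x) * sin (tau k * x))).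
  by apply: cont_add; apply: cont_scale; exact: cont_mul.
rewrite (_ : E _ = E (fun x => \sum_(k < n.+1)
  (a k * (cos (tau k * x) * cos (tau l * x)) + b k * (cos (tau l * x) * sin (tau k * x))))).
  rewrite Esum//.
  rewrite (eq_bigr (fun k : 'I_n.+1 => a k * ((k == l :> nat)%:R * cos_weight k))).
    have ln' : (l < n.+1)%N by [].
    rewrite (bigD1 (Ordinal ln'))//= eqxx mul1r big1 ?addr0; first exact: mulrC.
    move=> k /negP kl; rewrite (_ : _ == _ = false) ?mul0r ?mulr0//.
    by apply/negP => /eqP kE; apply: kl; apply/eqP/val_inj.
  move=> k _; have kn : (k <= n)%N by rewrite -ltnS.
  rewrite ED; [|by apply: cont_scale; exact: cont_mul..].
  rewrite !EZ; [|exact: cont_mul..].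
  by rewrite mean_cos_cos// mean_cos_sin// mulr0 addr0.
by apply: Eeq => x; rewrite /trig mulr_suml; apply: eq_bigr => k _; ring.
Qed.

Lemma mean_trig_sin a b l : (l <= n)%N ->
  E (fun x => trig n.+1 a b x * sin (tau l * x)) = sin_weight l * b l.
Proof.
move=> ln.
have cF (k : 'I_n.+1) : continuous (fun x =>
    a k * (cos (tau k * x) * sin (tau l * x)) + b k * (sin (tau k * x) * sin (tau l * x))).
  by apply: cont_add; apply: cont_scale; exact: cont_mul.
rewrite (_ : E _ = E (fun x => \sum_(k < n.+1)
  (a k * (cos (tau k * x) * sin (tau l * x)) + b k * (sin (tau k * x) * sin (tau l * x))))).
  rewrite Esum//.
  rewrite (eq_bigr (fun k : 'I_n.+1 => b k * ((k == l :> nat)%:R * sin_weight k))).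
    have ln' : (l < n.+1)%N by [].
    rewrite (bigD1 (Ordinal ln'))//= eqxx mul1r big1 ?addr0; first exact: mulrC.
    move=> k /negP kl; rewrite (_ : _ == _ = false) ?mul0r ?mulr0//.
    by apply/negP => /eqP kE; apply: kl; apply/eqP/val_inj.
  move=> k _; have kn : (k <= n)%N by rewrite -ltnS.
  rewrite ED; [|by apply: cont_scale; exact: cont_mul..].
  rewrite !EZ; [|exact: cont_mul..].
  by rewrite mean_cos_sin// mean_sin_sin// mulr0 add0r.
by apply: Eeq => x; rewrite /trig mulr_suml; apply: eq_bigr => k _; ring.
Qed.

Lemma mean_trig_sqr a b : E (fun x => trig n.+1 a b x ^+ 2) =
  \sum_(k < n.+1) (cos_weight k * a k ^+ 2 + sin_weight k * b k ^+ 2).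
Proof.
have ct : continuous (trig n.+1 a b) by exact: cont_trig.
have cF (k : 'I_n.+1) : continuous (fun x =>
    a k * (trig n.+1 a b x * cos (tau k * x)) + b k * (trig n.+1 a b x * sin (tau k * x))).
  by apply: cont_add; apply: cont_scale; exact: cont_mul.
rewrite (_ : E _ = E (fun x => \sum_(k < n.+1)
  (a k * (trig n.+1 a b x * cos (tau k * x)) + b k * (trig n.+1 a b x * sin (tau k * x))))).
  rewrite Esum//; apply: eq_bigr => k _.
  have kn : (k <= n)%N by rewrite -ltnS.
  rewrite ED; [|by apply: cont_scale; exact: cont_mul..].
  rewrite !EZ; [|exact: cont_mul..].
  by rewrite mean_trig_cos// mean_trig_sin//; ring.
apply: Eeq => x; rewrite expr2 {2}/trig mulr_sumr.
by apply: eq_bigr => k _; ring.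
Qed.

End Pairing.

Lemma itg_trig_sqr m a b : itg 0 1 (fun x => trig m.+1 a b x ^+ 2) =
  \sum_(k < m.+1) ((2^-1 * (1 + (k == 0%N :> nat)%:R)) * a k ^+ 2 +
                    (2^-1 * (1 - (k == 0%N :> nat)%:R)) * b k ^+ 2).
Proof.
rewrite (mean_trig_sqr (n := m) (@itgD _ 0 1) (@itgZ _ 0 1)).
- apply: eq_bigr => k _; rewrite /cos_weight /sin_weight itg_cos.
  by rewrite double_eq0.
- by rewrite itg_cos.
- by move=> r /andP[r0 _]; rewrite itg_cos gtn_eqF.
- by move=> r _; exact: itg_sin.
Qed.

End Trig.

(** * Interpolation on the grid *)

Section Grid.
Context {R : realType} (n : nat) (n0 : (0 < n)%N).
Implicit Types (x y t : R) (a b : nat -> R) (F : nat -> R) (k l m r j : nat).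

Local Notation N := (n.*2).

Definition grid_node j : R := j%:R / N%:R.

Let N0 : (N%:R : R) != 0. Proof. by rewrite pnatr_eq0; lia. Qed.
Let Npos : 0 < (N%:R : R). Proof. by rewrite ltr0n; lia. Qed.

Lemma tau_node k j : tau k * grid_node j = tau j * grid_node k :> R.
Proof. by rewrite /tau /grid_node; ring. Qed.

Lemma tau_nodeN k : tau k * grid_node N = tau k :> R.
Proof. by rewrite /grid_node divff// mulr1. Qed.

Lemma sin_tau_half r : (0 < r < N)%N -> 0 < sin (tau r * grid_node 1 / 2 : R).
Proof.
have N1 : (0 < N)%N by lia.
move=> /andP[r0 rN]; have -> : tau r * grid_node 1 / 2 = pi * (r%:R / N%:R) :> R.
  by rewrite /tau /grid_node; field.
apply: sin_gt0_pi; rewrite mulr_gt0 ?pi_gt0 ?divr_gt0 ?ltr0n//=.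
by rewrite -[ltRHS]mulr1 ltr_pM2l ?pi_gt0// ltr_pdivrMr// mul1r ltr_nat.
Qed.

(* Multiplying by [2 sin (tau r * grid_node 1 / 2)] makes the sum telescope. *)
Lemma sum_cos_node r x : (0 < r < N)%N ->
  \sum_(j < N) cos (tau r * grid_node j + x) = 0.
Proof.
move=> rN; have s0 := sin_tau_half rN; set h := tau r * grid_node 1 / 2 in s0.
have s20 : 2 * sin h != 0 by rewrite mulf_neq0// lt0r_neq0.
apply: (mulfI s20); rewrite mulr0.
have H m : 2 * sin h * \sum_(j < m) cos (tau r * grid_node j + x) =
    sin (tau r * grid_node m + x - h) - sin (x - h).
  elim: m => [|m IH].
    by rewrite big_ord0 /grid_node mul0r !mulr0 add0r subrr.
  rewrite big_ord_recr/= mulrDr IH.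
  have -> : tau r * grid_node m.+1 + x - h = tau r * grid_node m + x + h.
    by rewrite /h /tau /grid_node -[m.+1%:R]natr1; field.
  by rewrite !sinD cosN sinN; ring.
rewrite H tau_nodeN (_ : tau r + x - h = (x - h) + tau r); last by ring.
by rewrite [sin (_ + tau r)]sinD sin_tau1 cos_tau1; ring.
Qed.

Definition grid_mean (f : R -> R) : R := N%:R^-1 * \sum_(j < N) f (grid_node j).

Lemma grid_meanD (f g : R -> R) : continuous f -> continuous g ->
  grid_mean (fun x => f x + g x) = grid_mean f + grid_mean g.
Proof. by move=> _ _; rewrite /grid_mean big_split mulrDr. Qed.

Lemma grid_meanZ (c : R) (f : R -> R) : continuous f ->
  grid_mean (fun x => c * f x) = c * grid_mean f.
Proof. by move=> _; rewrite /grid_mean -mulr_sumr mulrCA. Qed.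

Lemma grid_mean_cos0 : grid_mean (fun x => cos (tau 0 * x)) = 1.
Proof.
rewrite /grid_mean (eq_bigr (fun=> 1)); last first.
  by move=> j _; rewrite /tau mulr0 mul0r cos0.
by rewrite sumr_const card_ord mulVf.
Qed.

Lemma grid_mean_cos r : (0 < r < N)%N -> grid_mean (fun x => cos (tau r * x)) = 0.
Proof.
move=> rN; rewrite /grid_mean (eq_bigr (fun j : 'I_N => cos (tau r * grid_node j + 0))).
  by rewrite sum_cos_node// mulr0.
by move=> j _; rewrite addr0.
Qed.

Lemma tauN_node j : tau N * grid_node j = tau j :> R.
Proof. by rewrite tau_node tau_nodeN. Qed.

Lemma grid_mean_cosN : grid_mean (fun x => cos (tau N * x)) = 1.
Proof.
rewrite /grid_mean (eq_bigr (fun=> 1)).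
  by rewrite sumr_const card_ord mulVf.
by move=> j _; rewrite tauN_node cos_tau1.
Qed.

Lemma grid_mean_sin r : (r <= N)%N -> grid_mean (fun x => sin (tau r * x)) = 0.
Proof.
move=> rN; have [->|r0] := posnP r.
  rewrite /grid_mean big1 ?mulr0// => j _.
  by rewrite /tau mulr0 mul0r sin0.
have [->|rN'] := eqVneq r N.
  by rewrite /grid_mean big1 ?mulr0// => j _; rewrite tauN_node sin_tau1.
rewrite /grid_mean (eq_bigr (fun j : 'I_N => cos (tau r * grid_node j + - (pi / 2)))).
  by rewrite sum_cos_node ?mulr0//; lia.
by move=> j _; rewrite cosBpihalf.
Qed.

(** For k <= n this is the number of frequencies z with - n < z <= n and |z| = k. *)
Definition mode_weight k : R := if (k == 0%N) || (k == n) then 1 else 2.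

Lemma cos_weight_grid k : (k <= n)%N -> cos_weight grid_mean k = (mode_weight k)^-1.
Proof.
move=> kn; rewrite /cos_weight /mode_weight; have [->|k0] := eqVneq k 0%N.
  by rewrite grid_mean_cos0/= invr1; field.
have [->|kn'] /= := eqVneq k n; first by rewrite grid_mean_cosN; field.
by rewrite grid_mean_cos ?addr0 ?mulr1//; lia.
Qed.

Lemma sin_weight_grid k : (k <= n)%N ->
  sin_weight grid_mean k = if (k == 0%N) || (k == n) then 0 else 2^-1.
Proof.
move=> kn; rewrite /sin_weight; have [->|k0] := eqVneq k 0%N.
  by rewrite grid_mean_cos0/= subrr mulr0.
have [->|kn'] /= := eqVneq k n; first by rewrite grid_mean_cosN subrr mulr0.
by rewrite grid_mean_cos ?subr0 ?mulr1//; lia.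
Qed.

Definition cos_coefficient F k : R := mode_weight k / N%:R * \sum_(j < N) F j * cos (tau k * grid_node j).
Definition sin_coefficient F k : R := mode_weight k / N%:R * \sum_(j < N) F j * sin (tau k * grid_node j).

Definition interp F : R -> R := trig n.+1 (cos_coefficient F) (sin_coefficient F).
(** The discrete derivative annihilates the mode n at the nodes, so this truncation is the
    polynomial that the scheme differentiates. *)
Definition interp_low F : R -> R := trig n (cos_coefficient F) (sin_coefficient F).

Let wt0 k : mode_weight k != 0. Proof. by rewrite /mode_weight; case: ifP => _; rewrite ?oner_neq0. Qed.

Lemma tau_half_node j : tau n * grid_node j = pi * j%:R :> R.
Proof.
rewrite /tau /grid_node -muln2 natrM; field.
by rewrite pnatr_eq0; lia.
Qed.

Lemma sin_pi_nat j : sin (pi * j%:R : R) = 0.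
Proof.
elim: j => [|j IH]; first by rewrite mulr0 sin0.
by rewrite -natr1 mulrDr mulr1 sinDpi IH oppr0.
Qed.

Lemma sin_coef_half F : sin_coefficient F n = 0.
Proof.
rewrite /sin_coefficient big1 ?mulr0// => j _.
by rewrite tau_half_node sin_pi_nat mulr0.
Qed.

Lemma cos_coef_trig a b k : (k <= n)%N ->
  cos_coefficient (fun j => trig n.+1 a b (grid_node j)) k = a k.
Proof.
move=> kn.
have := mean_trig_cos grid_meanD grid_meanZ grid_mean_cos0 grid_mean_cos
  grid_mean_sin a b kn.
rewrite cos_weight_grid// /cos_coefficient /grid_mean => h.
by rewrite -mulrA h mulrA divff// mul1r.
Qed.

Lemma sin_coef_trig a b k : (k <= n)%N -> (0 < k < n)%N ->
  sin_coefficient (fun j => trig n.+1 a b (grid_node j)) k = b k.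
Proof.
move=> kn k0n.
have := mean_trig_sin grid_meanD grid_meanZ grid_mean_cos0 grid_mean_cos
  grid_mean_sin a b kn.
rewrite sin_weight_grid// /sin_coefficient /grid_mean => h.
rewrite -mulrA h /mode_weight (_ : (k == 0%N) || (k == n) = false); last by lia.
by rewrite mulrA divff ?mul1r.
Qed.

(** The mode sin(tau n x) vanishes at all nodes; its coefficient is the one that sampling loses. *)
Lemma interp_trig a b x : interp (fun j => trig n.+1 a b (grid_node j)) x =
  trig n a b x + a n * cos (tau n * x).
Proof.
rewrite /interp /trig big_ord_recr/= sin_coef_half mul0r addr0 cos_coef_trig//.
congr (_ + _); apply: eq_bigr => k _; rewrite cos_coef_trig; last by rewrite ltnW.
have [k0|k0] := posnP k; first by rewrite k0 /tau mulr0 mul0r sin0 !mulr0.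
have kn : (0 < k < n)%N by rewrite k0 ltn_ord.
by rewrite (@sin_coef_trig a b k)//; apply/ltnW.
Qed.

(** The cardinal function of the grid, a Dirichlet kernel with its top mode halved; interpolation is
    discrete convolution with it. *)
Definition kernel_mass y : R := N%:R^-1 * \sum_(k < n.+1) mode_weight k * cos (tau k * y).

Lemma interpE F x : interp F x = \sum_(j < N) F j * kernel_mass (x - grid_node j).
Proof.
transitivity (\sum_(k < n.+1) \sum_(j < N)
    F j * (N%:R^-1 * (mode_weight k * cos (tau k * (x - grid_node j))))).
  rewrite /interp /trig; apply: eq_bigr => k _.
  rewrite /cos_coefficient /sin_coefficient !mulr_sumr !mulr_suml -big_split/=.
  apply: eq_bigr => j _; rewrite mulrBr cosB; ring.
rewrite exchange_big; apply: eq_bigr => j _.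
by rewrite /kernel_mass -mulr_sumr -mulr_sumr.
Qed.

(** By evenness the frequencies - n + 1, ..., 0 reverse to 0, ..., n - 1, and the others are 1, ...,
    n. So k is hit once if k < n and once more if 0 < k, which adds up to [mode_weight]. *)
Lemma sum_even_modes (G : int -> R) : (forall z : int, G (- z) = G z) ->
  \sum_(m < N) G (m%:Z - n%:Z + 1) = \sum_(k < n.+1) mode_weight k * G k%:Z.
Proof.
move=> Geven; rewrite -addnn big_split_ord/=.
rewrite (reindex_inj rev_ord_inj)/=.
rewrite (eq_bigr (fun k : 'I_n => G k%:Z)); last first.
  move=> k _; rewrite -Geven; congr G.
  by have := ltn_ord k; lia.
rewrite [X in _ + X](eq_bigr (fun k : 'I_n => G k.+1%:Z)); last first.
  by move=> k _; congr G; lia.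
have wtE (k : 'I_n.+1) : mode_weight k = (k < n)%:R + (0 < k)%:R.
  rewrite /mode_weight; have := ltn_ord k; move: (k : nat) => {}k kn.
  have [->|k0] := eqVneq k 0%N; first by rewrite n0 ltnn addr0.
  have [->|kn'] /= := eqVneq k n; first by rewrite ltnn n0 add0r.
  have -> : (k < n)%N by lia.
  have -> : (0 < k)%N by lia.
  by rewrite -natrD.
under [RHS]eq_bigr do rewrite wtE mulrDl.
rewrite big_split/= [X in _ = X + _]big_ord_recr/= ltnn mul0r addr0.
rewrite [X in _ = _ + X]big_ord_recl/= mul0r add0r; congr (_ + _).
  by apply: eq_bigr => k _; rewrite ltn_ord mul1r.
by apply: eq_bigr => k _; rewrite /bump/= add1n mul1r.
Qed.

(** Unfolded to all N frequencies, the kernel is a sum of cosines with step 2 pi (i - j) / N in the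
    frequency index. Frequency and node exchange roles, and [sum_cos_node] applies with r = i -
    j. *)
Lemma kernel_mass_node i j : (i < N)%N -> (j < N)%N ->
  kernel_mass (grid_node i - grid_node j) = (i == j)%:R.
Proof.
wlog ji : i j / (j <= i)%N => [H iN jN|iN jN].
  have [ji|/ltnW ij] := leqP j i; first exact: H.
  rewrite eq_sym -H// /kernel_mass; congr (_ * _); apply: eq_bigr => k _.
  by rewrite -cosN -mulrN opprB.
rewrite /kernel_mass.
rewrite (eq_bigr (fun k : 'I_n.+1 =>
   mode_weight k * cos (2 * pi * (k%:Z)%:~R * (grid_node i - grid_node j)))) //.
rewrite -(@sum_even_modes (fun z => cos (2 * pi * z%:~R * (grid_node i - grid_node j)))); last first.
  by move=> z; rewrite mulrNz mulrN mulNr cosN.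
have [->|ij] := eqVneq i j.
  rewrite (eq_bigr (fun=> 1)); last by move=> k _; rewrite subrr mulr0 cos0.
  by rewrite sumr_const card_ord mulVf.
rewrite (eq_bigr (fun k : 'I_N => cos (tau (i - j) * grid_node k +
    (2 * pi * (1 - n%:R) * (grid_node i - grid_node j))))); last first.
  move=> k _; congr cos; rewrite /tau /grid_node natrB//.
  by rewrite rmorphD rmorphB/= -!pmulrn; field.
by rewrite sum_cos_node ?mulr0//; lia.
Qed.

Lemma interp_node F i : (i < N)%N -> interp F (grid_node i) = F i.
Proof.
move=> iN; rewrite interpE (bigD1 (Ordinal iN))//= kernel_mass_node// eqxx mulr1.
rewrite big1 ?addr0// => j /negP ji; rewrite kernel_mass_node//.
rewrite (_ : _ == _ = false) ?mulr0//; apply/negP => /eqP E; apply: ji.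
by apply/eqP/val_inj; rewrite /= E.
Qed.

(** One factor F j is replaced by the interpolant at its node; summing over j first turns the
    products back into coefficients, up to the normalisation [mode_weight k / N]. *)
Lemma grid_parseval F : N%:R^-1 * \sum_(j < N) F j ^+ 2 =
  \sum_(k < n.+1) (mode_weight k)^-1 * (cos_coefficient F k ^+ 2 + sin_coefficient F k ^+ 2).
Proof.
transitivity (\sum_(k < n.+1) \sum_(j < N) N%:R^-1 *
    (F j * (cos_coefficient F k * cos (tau k * grid_node j) + sin_coefficient F k * sin (tau k * grid_node j)))).
  rewrite exchange_big mulr_sumr; apply: eq_bigr => j _ /=.
  by rewrite -!mulr_sumr -[in LHS](interp_node F (ltn_ord j)) expr2 {1}interp_node.
apply: eq_bigr => k _; rewrite -mulr_sumr.
have -> : \sum_(j < N) F j * (cos_coefficient F k * cos (tau k * grid_node j) +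
    sin_coefficient F k * sin (tau k * grid_node j)) =
  cos_coefficient F k * (\sum_(j < N) F j * cos (tau k * grid_node j)) +
  sin_coefficient F k * (\sum_(j < N) F j * sin (tau k * grid_node j)).
  by rewrite !mulr_sumr -big_split; apply: eq_bigr => j _ /=; ring.
rewrite /cos_coefficient /sin_coefficient; set X := \sum_(j < N) _; set Z := \sum_(j < N) _.
by field; rewrite wt0 N0.
Qed.

End Grid.

(** * A lower bound for the sine *)

Section Jordan.
Context {R : realType}.
Implicit Types (x : R).

(* sin y = y cos c for some c in [0, y], and cos c >= cos (pi / 4) for y <= pi / 4. *)
Lemma sin_ge_half x : 0 <= x <= pi / 2 -> x / 2 <= sin x.
Proof.
move=> /andP[x0 xpi]; pose y := x / 2.
have y0 : 0 <= y by rewrite /y; lra.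
have p0 : 0 < pi :> R by exact: pi_gt0.
have cy : 0 <= cos y.
  by apply: cos_ge0_pihalf; rewrite /y; apply/andP; split; lra.
have [c cc sE] : exists2 c, 0 <= c <= y & sin y = cos c * y.
  have [|c cI E] := @MVT_segment R sin cos 0 y y0.
    by apply: continuous_subspaceT; exact: continuous_sin.
  by exists c; [move: cI; rewrite in_itv|move: E; rewrite sin0 !subr0].
have cyc : cos y <= cos c.
  move: cc => /andP[c0]; rewrite le_eqVlt => /predU1P[->//|cy'].
  by rewrite ltW// ltr_cos// in_itv/=; apply/andP; split; rewrite /y in cy' *; lra.
have c2 : 2^-1 <= cos y ^+ 2.
  have h : 0 <= cos (y *+ 2).
    by apply: cos_ge0_pihalf; rewrite -mulr_natl /y; apply/andP; split; lra.
  move: h; rewrite cos_mulr2n -mulr_natl; lra.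
have -> : x = y *+ 2 by rewrite -mulr_natl /y; field.
rewrite sin_mulr2n sE -[leRHS]mulr_natl -[y *+ 2]mulr_natl.
have : cos y ^+ 2 * y <= cos y * (cos c * y).
  by rewrite expr2 -mulrA ler_wpM2l// ler_wpM2r.
nra.
Qed.

End Jordan.

(** * Aliasing and inverse estimates on the grid *)

Section GridEstimates.
Context {R : realType} (n : nat) (n0 : (0 < n)%N).
Implicit Types (x y t : R) (a b : nat -> R) (F : nat -> R) (k l m r j : nat).

Local Notation N := (n.*2).
Local Notation node := (grid_node n).
Local Notation cos_coef := (cos_coefficient n).
Local Notation sin_coef := (sin_coefficient n).
Local Notation wt := (mode_weight n).

Let N0 : (N%:R : R) != 0. Proof. by rewrite pnatr_eq0; lia. Qed.
Let Npos : 0 < (N%:R : R). Proof. by rewrite ltr0n; lia. Qed.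
Let NE : (N%:R : R) = 2 * n%:R. Proof. by rewrite -muln2 natrM mulrC. Qed.
Let wt0 k : wt k != 0 :> R. Proof. by rewrite /wt; case: ifP => _; rewrite ?oner_neq0. Qed.
Let wt_gt0 k : 0 < wt k :> R. Proof. by rewrite /wt; case: ifP => _; rewrite ?ltr01 ?ltr0n. Qed.

Lemma sum_shift m (H : nat -> R) : H m = H 0%N ->
  \sum_(j < m) H j.+1 = \sum_(j < m) H j.
Proof.
move=> Hm; apply: (@addrI _ (H 0%N)).
transitivity (\sum_(j < m.+1) H j).
  by rewrite big_ord_recl/=; congr (_ + _); apply: eq_bigr => j _; rewrite /bump add1n.
by rewrite big_ord_recr/= Hm addrC.
Qed.

Let th k : R := tau k * node 1.

Let tau_nodeS k j : tau k * node j = tau k * node j.+1 - th k.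
Proof. by rewrite /th /node /grid_node -[j.+1%:R]natr1; field. Qed.

(** A shift by one node rotates the pair of coefficients of frequency k by the angle [th k];
    [F N = F 0] closes the reindexed sum. *)
Lemma cos_coef_diff F k : F N = F 0%N ->
  cos_coef (fun j => F j.+1 - F j) k =
  cos (th k) * cos_coef F k + sin (th k) * sin_coef F k - cos_coef F k.
Proof.
move=> FN; pose H j := F j * cos (tau k * node j - th k).
have HN : H N = H 0%N.
  rewrite /H FN tau_nodeN// (_ : node 0 = 0) ?mulr0 ?sub0r; last by rewrite /grid_node mul0r.
  by rewrite cosB cos_tau1 sin_tau1 mul1r mul0r addr0 cosN.
have := sum_shift HN; rewrite /H => E.
rewrite /cos_coef /cos_coefficient.
rewrite (eq_bigr (fun j : 'I_N => F j.+1 * cos (tau k * node j.+1 - th k) -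
   F j * cos (tau k * node j))); last first.
  by move=> j _; rewrite mulrBl -tau_nodeS.
rewrite sumrB E /sin_coef /sin_coefficient.
rewrite (eq_bigr (fun j : 'I_N => cos (th k) * (F j * cos (tau k * node j)) +
   sin (th k) * (F j * sin (tau k * node j)))); last first.
  by move=> j _; rewrite cosB; ring.
by rewrite big_split/= -!mulr_sumr; ring.
Qed.

Lemma sin_coef_diff F k : F N = F 0%N ->
  sin_coef (fun j => F j.+1 - F j) k =
  cos (th k) * sin_coef F k - sin (th k) * cos_coef F k - sin_coef F k.
Proof.
move=> FN; pose H j := F j * sin (tau k * node j - th k).
have HN : H N = H 0%N.
  rewrite /H FN tau_nodeN// (_ : node 0 = 0) ?mulr0 ?sub0r; last by rewrite /grid_node mul0r.
  by rewrite sinB cos_tau1 sin_tau1 mul1r mul0r sub0r sinN.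
have := sum_shift HN; rewrite /H => E.
rewrite /sin_coef /sin_coefficient.
rewrite (eq_bigr (fun j : 'I_N => F j.+1 * sin (tau k * node j.+1 - th k) -
   F j * sin (tau k * node j))); last first.
  by move=> j _; rewrite mulrBl -tau_nodeS.
rewrite sumrB E /cos_coef /cos_coefficient.
rewrite (eq_bigr (fun j : 'I_N => cos (th k) * (F j * sin (tau k * node j)) -
   sin (th k) * (F j * cos (tau k * node j)))); last first.
  by move=> j _; rewrite sinB; ring.
by rewrite sumrB/= -!mulr_sumr; ring.
Qed.

(** Here 2 - 2 cos is 4 sin^2 of the half angle z = pi k / N, which is at most pi / 2, where sin z
    >= z / 2. *)
Let th_le k : (k <= n)%N -> (pi * k%:R / N%:R) ^+ 2 <= 2 - 2 * cos (th k).
Proof.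
move=> kn; pose z : R := pi * k%:R / N%:R.
have -> : th k = z *+ 2 by rewrite -mulr_natl /th /z /tau /grid_node; field.
have p0 : 0 < pi :> R by exact: pi_gt0.
have z0 : 0 <= z.
  by apply: divr_ge0; [apply: mulr_ge0 => //; exact: ltW|exact: ltW].
have zpi : z <= pi / 2.
  rewrite /z NE -mulrA ler_pM2l// ler_pdivrMr ?mulr_gt0 ?ltr0n//.
  by rewrite mulrA mulVf ?mul1r ?ler_nat// pnatr_eq0.
have zz : 0 <= z <= pi / 2 by rewrite z0 zpi.
have h := sin_ge_half zz.
have h2 : (z / 2) ^+ 2 <= sin z ^+ 2.
  have z20 : 0 <= z / 2 by rewrite divr_ge0.
  by rewrite ler_sqr// nnegrE// (le_trans z20).
rewrite cos_mulr2n -[_ *+ 2]mulr_natl cos2sin2 -/z; lra.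
Qed.

Section Samples.
Context (g dg : R -> R) (dgE : forall x : R, is_derive x 1 g (dg x)).
Context (cdg : continuous dg) (g01 : g 1 = g 0).

Let F j := g (node j).
Let G := itg 0 1 (fun x => dg x ^+ 2).

Let FN : F N = F 0%N.
Proof. by rewrite /F /grid_node divff// mul0r g01. Qed.

(** Parseval for the forward differences of the samples: a rotation by [th k] minus the identity
    multiplies squared lengths by 2 - 2 cos(th k), and Cauchy-Schwarz on the cells bounds the
    differences. Since [g] may have any frequencies, this applies to u^2. *)
Lemma sampled_gradient_le :
  \sum_(k < n.+1) (pi * k%:R) ^+ 2 / wt k * (cos_coef F k ^+ 2 + sin_coef F k ^+ 2) <= G.
Proof.
have N1 : (0 < N)%N by lia.
have := sum_sqr_increment_le N1 cdg dgE; rewrite -/G => H.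
have := grid_parseval n0 (fun j => F j.+1 - F j) => P.
have {H P} : \sum_(k < n.+1) (wt k)^-1 * (cos_coef (fun j => F j.+1 - F j) k ^+ 2 +
    sin_coef (fun j => F j.+1 - F j) k ^+ 2) <= N%:R^-1 * (N%:R^-1 * G).
  by rewrite -P ler_wpM2l// invr_ge0 ltW.
rewrite mulrA -[_ * _ * G]mulrC -invfM -expr2 ler_pdivlMr ?exprn_gt0// => H.
apply: le_trans H; rewrite mulr_suml; apply: ler_sum => k _.
have kn : (k <= n)%N by rewrite -ltnS.
rewrite cos_coef_diff// sin_coef_diff//.
set A := cos_coef F k; set B := sin_coef F k.
have -> : (cos (th k) * A + sin (th k) * B - A) ^+ 2 +
    (cos (th k) * B - sin (th k) * A - B) ^+ 2 =
    (2 - 2 * cos (th k)) * (A ^+ 2 + B ^+ 2) +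
      (sin (th k) ^+ 2 + cos (th k) ^+ 2 - 1) * (A ^+ 2 + B ^+ 2) by ring.
rewrite [sin _ ^+ 2 + _]addrC cos2Dsin2 subrr mul0r addr0.
have := th_le kn; rewrite expr_div_n ler_pdivrMr ?exprn_gt0// => h.
have AB : 0 <= A ^+ 2 + B ^+ 2 by rewrite addr_ge0 ?sqr_ge0.
have w0 : 0 <= (wt k)^-1 :> R by rewrite invr_ge0 ltW.
have := ler_wpM2r AB (ler_wpM2r w0 h); lra.
Qed.

Let term_le k : (k <= n)%N ->
  (pi * k%:R) ^+ 2 / wt k * (cos_coef F k ^+ 2 + sin_coef F k ^+ 2) <= G.
Proof.
move=> kn; have kn' : (k < n.+1)%N by [].
apply: le_trans sampled_gradient_le; rewrite (bigD1 (Ordinal kn'))//= lerDl.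
apply: sumr_ge0 => i _; rewrite mulr_ge0 ?addr_ge0 ?sqr_ge0//.
by rewrite divr_ge0 ?sqr_ge0// ltW.
Qed.

(** The single term k = n of the preceding sum, with pi n >= 2 n = N. *)
Lemma half_mode_le : cos_coef F n ^+ 2 <= N%:R^-1 ^+ 2 * G.
Proof.
have := term_le (leqnn n); rewrite sin_coef_half// expr0n/= addr0.
rewrite /wt /mode_weight eqxx orbT divr1 => h.
rewrite [leRHS]mulrC exprVn ler_pdivlMr ?exprn_gt0//; apply: le_trans h; rewrite mulrC.
rewrite ler_wpM2r ?sqr_ge0// ler_sqr ?nnegrE ?mulr_ge0 ?pi_ge0 ?(ltW Npos)//.
by rewrite NE ler_wpM2r// pi_ge2.
Qed.

Let Sd : R -> R := trig n (fun k => tau k * sin_coef F k) (fun k => - (tau k * cos_coef F k)).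

Let dS x : is_derive x 1 (interp_low n F) (Sd x).
Proof. exact: der_trig. Qed.

Let cSd : continuous Sd. Proof. exact: cont_trig. Qed.

(** For 0 < k < n the mode k enters the integral with the factor (tau k)^2 / 2 and the discrete sum
    with (pi k)^2 / 2; their ratio is 4. *)
Lemma itg_deriv_interp_low_le : itg 0 1 (fun x => Sd x ^+ 2) <= 4 * G.
Proof.
apply: (@le_trans _ _ (4 * \sum_(k < n.+1) (pi * k%:R) ^+ 2 / wt k *
  (cos_coef F k ^+ 2 + sin_coef F k ^+ 2))); last by rewrite ler_wpM2l// sampled_gradient_le.
(* A zero mode n is appended so that both sums run over k <= n. *)
pose a k := if k == n then 0 else tau k * sin_coef F k.
pose b k := if k == n then 0 else - (tau k * cos_coef F k).
have -> : itg 0 1 (fun x => Sd x ^+ 2) = itg 0 1 (fun x => trig n.+1 a b x ^+ 2).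
  apply: eq_itg => x _; congr (_ ^+ 2); rewrite /Sd /trig big_ord_recr/= /a /b eqxx.
  rewrite !mul0r !addr0; apply: eq_bigr => k _.
  by rewrite (_ : _ == n = false)//; have := ltn_ord k; lia.
rewrite itg_trig_sqr.
rewrite mulr_sumr; apply: ler_sum => k _.
have [kn|kn] := eqVneq (k : nat) n.
  rewrite /a /b kn eqxx expr0n/= !mulr0 addr0 mulr_ge0// mulr_ge0 ?addr_ge0 ?sqr_ge0//.
  by rewrite divr_ge0 ?sqr_ge0// ltW.
rewrite /a /b (negPf kn).
have [k0|k0] := posnP k.
  by rewrite k0 /tau !mulr0 !mul0r oppr0 expr0n/= !mulr0 !mul0r addr0 mulr0.
have kz : (k == 0%N :> nat) = false by rewrite gtn_eqF.
rewrite /wt /mode_weight (negPf kn) kz/= addr0 subr0 /tau.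
by rewrite le_eqVlt; apply/orP; left; apply/eqP; field.
Qed.

Let dgS x : is_derive x 1 (fun x => g x - interp_low n F x) (dg x - Sd x).
Proof. exact: der_sub. Qed.

(** At a node [g] equals its full interpolant, so the error there is the top mode alone, bounded by
    [half_mode_le]; the derivative of the error has energy at most 9 G. The cell inequality then
    gives 20 = 2 + 2 * 9. *)
Lemma interp_low_error_le :
  itg 0 1 (fun x => (g x - interp_low n F x) ^+ 2) <= 20 * N%:R^-1 ^+ 2 * G.
Proof.
have N1 : (0 < N)%N by lia.
have cdgS : continuous (fun x => dg x - Sd x) by exact: cont_sub.
apply: (le_trans (itg_sqr_le_cells N1 cdgS dgS)).
have h1 : \sum_(j < N) (g (j%:R / N%:R) - interp_low n F (j%:R / N%:R)) ^+ 2 <=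
    N%:R * (N%:R^-1 ^+ 2 * G).
  rewrite (_ : N%:R * _ = \sum_(j < N) N%:R^-1 ^+ 2 * G); last first.
    by rewrite sumr_const card_ord mulr_natl.
  apply: ler_sum => j _.
  rewrite -/(node j) -/(F j) -(interp_node n0 F (ltn_ord j)) /interp /trig big_ord_recr/=.
  rewrite /interp_low /trig addrAC subrr add0r.
  rewrite sin_coef_half// mul0r addr0 exprMn.
  apply: le_trans half_mode_le; rewrite ler_piMr ?sqr_ge0//.
have h2 : itg 0 1 (fun x => (dg x - Sd x) ^+ 2) <= 9 * G.
  apply: (@le_trans _ _ (3 * G + 3 / 2 * itg 0 1 (fun x => Sd x ^+ 2))).
    have c1 := cont_exp 2 cdg; have c2 := cont_exp 2 cSd; have c3 := cont_exp 2 cdgS.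
    rewrite -!itgZ// -itgD; [|exact: cont_scale..].
    apply: itg_le; [exact: c3|by apply: cont_add; exact: cont_scale|].
    by move=> x _; have := sqr_ge0 (2 * dg x + Sd x); lra.
  by have := itg_deriv_interp_low_le; lra.
have G0 : 0 <= G by apply: itg_ge0 => *; exact: sqr_ge0.
have N2 : 0 < N%:R^-1 ^+ 2 :> R by rewrite exprn_gt0 ?invr_gt0.
have -> : 20 * N%:R^-1 ^+ 2 * G = 2 * N%:R^-1 * (N%:R * (N%:R^-1 ^+ 2 * G)) +
    2 * N%:R^-1 ^+ 2 * (9 * G) by field.
apply: lerD; first by rewrite ler_wpM2l// mulr_ge0// invr_ge0 ltW.
by rewrite ler_wpM2l// mulr_ge0// ltW.
Qed.

End Samples.

(** The frequencies satisfy tau k <= 2 pi n = pi N <= 4 N. *)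
Lemma bernstein a b : itg 0 1 (fun x =>
    trig n.+1 (fun k => tau k * b k) (fun k => - (tau k * a k)) x ^+ 2) <=
  16 * N%:R ^+ 2 * itg 0 1 (fun x => trig n.+1 a b x ^+ 2).
Proof.
rewrite !itg_trig_sqr mulr_sumr; apply: ler_sum => k _.
have [k0|k0] := posnP k.
  rewrite k0 /tau mulr0 !mul0r oppr0 expr0n/= !mulr0 addr0 subrr mulr0 mul0r addr0.
  by apply: mulr_ge0; [apply: mulr_ge0 => //; exact: sqr_ge0|apply: mulr_ge0; rewrite ?sqr_ge0].
rewrite addr0 subr0 mulr1 sqrrN.
have kn : tau k ^+ 2 <= 16 * N%:R ^+ 2 :> R.
  have -> : 16 * N%:R ^+ 2 = (4 * N%:R) ^+ 2 :> R by ring.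
  rewrite ler_sqr ?nnegrE ?mulr_ge0 ?pi_ge0//.
  rewrite /tau NE; have : (k%:R : R) <= n%:R by rewrite ler_nat -ltnS.
  have := @pihalf_lt2 R; have := @pi_gt0 R; have : 0 <= (k%:R : R) by [].
  by nra.
have AB : 0 <= a k ^+ 2 + b k ^+ 2 by rewrite addr_ge0 ?sqr_ge0.
by have := ler_wpM2r AB kn; rewrite !exprMn; lra.
Qed.

End GridEstimates.

(** * The collocation scheme *)

Section DiscreteBurgers.
Context {R : realType} (n : nat) (n0 : (0 < n)%N).
Implicit Types (x y t : R) (a b : nat -> R) (F : nat -> R) (k l m j : nat).

Local Notation N := (n.*2).
Local Notation node := (grid_node n).
Local Notation cos_coef := (cos_coefficient n).
Local Notation sin_coef := (sin_coefficient n).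
Local Notation wt := (mode_weight n).

Definition laplacian_samples F j : R :=
  trig n.+1 (fun k => - tau k ^+ 2 * cos_coef F k) (fun k => - tau k ^+ 2 * sin_coef F k)
    (node j).

Definition gradient_samples F j : R :=
  trig n.+1 (fun k => tau k * sin_coef F k) (fun k => - (tau k * cos_coef F k)) (node j).

Definition burgers_rhs F j : R :=
  laplacian_samples F j - 2^-1 * gradient_samples (fun j => F j ^+ 2) j.

Lemma eq_coef F1 F2 : (forall j, (j < N)%N -> F1 j = F2 j) ->
  cos_coef F1 = cos_coef F2 /\ sin_coef F1 = sin_coef F2.
Proof.
move=> E; split; apply/funext => k.
  by rewrite /cos_coefficient; congr (_ * _); apply: eq_bigr => j _; rewrite E.
by rewrite /sin_coefficient; congr (_ * _); apply: eq_bigr => j _; rewrite E.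
Qed.

(** Sampling loses the sine of frequency n. The Laplacian contains none, as [sin_coefficient n F n]
    is 0, but the derivative of the top cosine is exactly that sine; so the interpolated flow
    differentiates the truncated interpolant of the squares. *)
Lemma interp_burgers_rhs F x : interp n (burgers_rhs F) x =
  trig n.+1 (fun k => - tau k ^+ 2 * cos_coef F k) (fun k => - tau k ^+ 2 * sin_coef F k) x -
  2^-1 * trig n (fun k => tau k * sin_coef (fun j => F j ^+ 2) k)
                (fun k => - (tau k * cos_coef (fun j => F j ^+ 2) k)) x.
Proof.
pose A2 := cos_coef (fun j => F j ^+ 2); pose B2 := sin_coef (fun j => F j ^+ 2).
pose a k := - tau k ^+ 2 * cos_coef F k - 2^-1 * (tau k * B2 k).
pose b k := - tau k ^+ 2 * sin_coef F k + 2^-1 * (tau k * A2 k).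
have -> : burgers_rhs F = fun j => trig n.+1 a b (node j).
  apply/funext => j; rewrite /burgers_rhs /laplacian_samples /gradient_samples /trig.
  rewrite mulr_sumr -sumrB; apply: eq_bigr => k _.
  by rewrite /a /b /A2 /B2; ring.
rewrite interp_trig// [in RHS]/trig big_ord_recr/= sin_coef_half//.
rewrite {2}/a /B2 sin_coef_half// !mulr0 mul0r subr0 addr0 addrAC; congr (_ + _).
rewrite /trig mulr_sumr -sumrB; apply: eq_bigr => k _.
by rewrite /a /b /A2 /B2; ring.
Qed.

Context (v : nat -> R -> R) (cv : forall j, continuous (v j)).
Context (dv : forall j t, (j < N)%N -> 0 < t ->
  is_derive t 1 (v j) (burgers_rhs (v^~ t) j)).

Let c (i : 'I_N) : R -> R := v i.
Let c' (i : 'I_N) t : R := burgers_rhs (v^~ t) i.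
(** Coefficients of the cardinal function: [g i] is [kernel_mass] centred at the node i, and the
    other coefficients belong to its first two derivatives. *)
Let a0 k : R := wt k / N%:R.
Let b0 k : R := 0.
Let d1a k : R := tau k * b0 k.
Let d1b k : R := - (tau k * a0 k).
Let d2a k : R := tau k * d1b k.
Let d2b k : R := - (tau k * d1a k).
Let g (i : 'I_N) x : R := trig n.+1 a0 b0 (x - node i).
Let g1 (i : 'I_N) x : R := trig n.+1 d1a d1b (x - node i).
Let g2 (i : 'I_N) x : R := trig n.+1 d2a d2b (x - node i).

Let dshift a b y x : is_derive x 1 (fun x => trig n.+1 a b (x - y))
  (trig n.+1 (fun k => tau k * b k) (fun k => - (tau k * a k)) (x - y)).
Proof.
rewrite -[X in is_derive _ _ _ X]mulr1.
apply: (@der_comp _ _ (trig n.+1 a b) (fun x => x - y)); first exact: der_trig.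
by rewrite -[X in is_derive _ _ _ X]subr0; apply: der_sub.
Qed.

Let dg i x : is_derive x 1 (g i) (g1 i x). Proof. exact: dshift. Qed.
Let dg1 i x : is_derive x 1 (g1 i) (g2 i x). Proof. exact: dshift. Qed.
Let cg2 i : continuous (g2 i). Proof. exact: der_cont (dshift d2a d2b (node i)). Qed.

Let shift01 a b y : trig n.+1 a b (1 - y) = trig n.+1 a b (0 - y).
Proof. by rewrite sub0r addrC trig_periodic. Qed.

Let cc i : continuous (c i). Proof. exact: cv. Qed.

Let ccoef (w : nat -> R -> R) k : (forall j, continuous (w j)) ->
  continuous (fun t => cos_coef (w^~ t) k) /\ continuous (fun t => sin_coef (w^~ t) k).
Proof.
move=> cw; split; apply: cont_scale; apply: cont_sum => j _; apply: cont_mul => //;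
  exact: cst_continuous.
Qed.

Let cc' i : continuous (c' i).
Proof.
have [cA cB] : (forall k, continuous (fun t => cos_coef (v^~ t) k)) /\
    (forall k, continuous (fun t => sin_coef (v^~ t) k)).
  by split=> k; have [] := @ccoef v k cv.
have cv2 j : continuous (fun t => v j t ^+ 2) by exact: cont_exp.
have [cA2 cB2] : (forall k, continuous (fun t => cos_coef (fun j => v j t ^+ 2) k)) /\
    (forall k, continuous (fun t => sin_coef (fun j => v j t ^+ 2) k)).
  by split=> k; have [] := @ccoef (fun j t => v j t ^+ 2) k cv2.
apply: cont_sub; last apply: cont_scale.
  apply: cont_sum => k _; apply: cont_add; apply: cont_mul; try exact: cst_continuous.
    exact: cont_scale.
  exact: cont_scale.
apply: cont_sum => k _; apply: cont_add; apply: cont_mul; try exact: cst_continuous.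
  exact: cont_scale.
by apply: cont_opp; exact: cont_scale.
Qed.

Let uE t : separated c g t = interp n (v^~ t).
Proof.
apply/funext => x; rewrite interpE /separated; apply: eq_bigr => j _.
rewrite /c /g; congr (_ * _); rewrite /kernel_mass /trig mulr_sumr.
by apply: eq_bigr => k _; rewrite /a0 /b0 mul0r addr0; ring.
Qed.

Let utE t : separated c' g t = interp n (burgers_rhs (v^~ t)).
Proof.
apply/funext => x; rewrite interpE /separated; apply: eq_bigr => j _.
rewrite /c' /g; congr (_ * _); rewrite /kernel_mass /trig mulr_sumr.
by apply: eq_bigr => k _; rewrite /a0 /b0 mul0r addr0; ring.
Qed.

Let uxE t : separated c g1 t = trig n.+1 (fun k => tau k * sin_coef (v^~ t) k)
  (fun k => - (tau k * cos_coef (v^~ t) k)).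
Proof.
apply/funext => x.
have h1 : is_derive x 1 (separated c g t) (separated c g1 t x) by exact: separated_deriver.
have h2 : is_derive x 1 (separated c g t) (trig n.+1 (fun k => tau k * sin_coef (v^~ t) k)
  (fun k => - (tau k * cos_coef (v^~ t) k)) x) by rewrite uE; exact: der_trig.
by rewrite -(@derive_val _ _ _ _ _ _ _ h1) (@derive_val _ _ _ _ _ _ _ h2).
Qed.

Let uxxE t : separated c g2 t = trig n.+1 (fun k => - tau k ^+ 2 * cos_coef (v^~ t) k)
  (fun k => - tau k ^+ 2 * sin_coef (v^~ t) k).
Proof.
apply/funext => x.
have h1 : is_derive x 1 (separated c g1 t) (separated c g2 t x) by exact: separated_deriver.
have h2 : is_derive x 1 (separated c g1 t)
    (trig n.+1 (fun k => - tau k ^+ 2 * cos_coef (v^~ t) k)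
      (fun k => - tau k ^+ 2 * sin_coef (v^~ t) k) x).
  rewrite uxE; have := @der_trig R n.+1 (fun k => tau k * sin_coef (v^~ t) k)
    (fun k => - (tau k * cos_coef (v^~ t) k)) x.
  congr is_derive; rewrite /trig; apply: eq_bigr => k _; ring.
by rewrite -(@derive_val _ _ _ _ _ _ _ h1) (@derive_val _ _ _ _ _ _ _ h2).
Qed.

Let sq t x : R := separated c g t x ^+ 2.
Let dsq t x : R := 2 * separated c g t x * separated c g1 t x.
Let F2 t j : R := sq t (node j).
Let Sd t x : R := trig n (fun k => tau k * sin_coef (F2 t) k)
  (fun k => - (tau k * cos_coef (F2 t) k)) x.
Let h t x : R := 2^-1 * (sq t x - interp_low n (F2 t) x).
Let hx t x : R := 2^-1 * (dsq t x - Sd t x).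

Let cu t : continuous (separated c g t).
Proof. by apply: separated_contr => i; exact: der_cont (dg i). Qed.
Let cux t : continuous (separated c g1 t).
Proof. by apply: separated_contr => i; exact: der_cont (dg1 i). Qed.
Arguments cu : clear implicits.
Arguments cux : clear implicits.

Let dsqE t x : is_derive x 1 (sq t) (dsq t x).
Proof.
have du : is_derive x 1 (separated c g t) (separated c g1 t x).
  exact: separated_deriver.
by have := der_exp 1 du; rewrite expr1.
Qed.

Let cdsq t : continuous (dsq t).
Proof. by apply: cont_mul; [apply: cont_scale; exact: cu|exact: cux]. Qed.
Arguments cdsq : clear implicits.

Let sq01 t : sq t 1 = sq t 0.
Proof. by rewrite /sq uE /interp trig01. Qed.

Let F2E t : cos_coef (F2 t) = cos_coef (fun j => v j t ^+ 2) /\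
  sin_coef (F2 t) = sin_coef (fun j => v j t ^+ 2).
Proof.
by apply: eq_coef => j jN; rewrite /F2 /sq uE interp_node.
Qed.

Let evolution t x : separated c' g t x = separated c g2 t x - 2^-1 * Sd t x.
Proof. by rewrite utE uxxE interp_burgers_rhs /Sd; have [-> ->] := F2E t. Qed.

Let energy_dsq t (Z : R) : (forall x, 0 <= x <= 1 -> separated c g t x ^+ 2 <= Z) ->
  itg 0 1 (fun x => dsq t x ^+ 2) <=
  4 * (Z * itg 0 1 (fun x => separated c g1 t x ^+ 2)).
Proof.
move=> uZ; have c2 := cont_exp 2 (cux t).
rewrite -!itgZ//; last exact: cont_scale.
apply: itg_le; [exact: cont_exp 2 (cdsq t)|apply: cont_scale; exact: cont_scale|].
move=> x x01; rewrite /dsq !exprMn -mulrA (_ : 2 ^+ 2 = 4 :> R); last by ring.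
by rewrite ler_wpM2l// ler_wpM2r ?sqr_ge0// uZ.
Qed.

Let y t := itg 0 1 (fun x => trig n.+1 (fun k => tau k * sin_coef (v^~ t) k)
  (fun k => - (tau k * cos_coef (v^~ t) k)) x ^+ 2).

Theorem collocation_maximum_principle (r M : R) :
  itg 0 1 (fun x => interp n (v^~ 0) x ^+ 2) = r ^+ 2 ->
  1440 * (r ^+ 2 + 1) <= N%:R ->
  (forall x, 0 <= x <= 1 -> `|interp n (v^~ 0) x| <= M) ->
  forall t j, 0 <= t -> (j < N)%N ->
  `|v j t| <= M + Num.sqrt (overshoot r (y 0) / N%:R).
Proof.
move=> e0 Nbig M0 t j t0 jN.
have Npos : 0 < N%:R :> R by rewrite ltr0n; lia.
have N1 : 1 <= N%:R :> R by rewrite ler1n; lia.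
pose xj : R := node j.
have x01 : 0 <= xj <= 1.
  apply/andP; split; first by apply: divr_ge0.
  by rewrite /xj /grid_node ler_pdivrMr// mul1r ler_nat ltnW.
have := @effective_maximum_principle R N c c' g g1 g2 h hx N%:R r M cc cc' _ dg dg1 cg2 _ _
  _ _ _ _ N1 _ _ _ _ Nbig _ t xj t0 x01.
rewrite (uE 0) (uE t) uxE /xj interp_node//; apply.
- by move=> i s s0; exact: dv.
- by move=> i; exact: shift01.
- by move=> i; exact: shift01.
- move=> s x; apply: der_scale; apply: der_sub; first exact: dsqE.
  exact: der_trig.
- by move=> s; apply: cont_scale; apply: cont_sub; [exact: cdsq|exact: cont_trig].
- by move=> s; rewrite /h sq01 /interp_low trig01.
- by move=> s x s0; rewrite evolution /hx /dsq; field.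
- move=> s Z s0 uZ.
  have := @interp_low_error_le R n n0 (sq s) (dsq s) (dsqE s) (cdsq s) (sq01 s).
  have := energy_dsq uZ; set D := itg 0 1 (fun x => dsq s x ^+ 2) => D1 D2.
  have ce : continuous (fun x => (sq s x - interp_low n (F2 s) x) ^+ 2).
    apply: cont_exp; apply: cont_sub; last exact: cont_trig.
    exact: der_cont (dsqE s).
  (* The 1/4 from the square of the factor 1/2 in [h] cancels the 4 of [energy_dsq], leaving the
     constant 20. *)
  rewrite (_ : itg _ _ _ = 4^-1 * itg 0 1 (fun x => (sq s x - interp_low n (F2 s) x) ^+ 2)).
    have Ni : 0 <= (N%:R : R)^-1 ^+ 2 by exact: sqr_ge0.
    have := ler_wpM2l Ni D1; move: D2; rewrite -/(F2 s); lra.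
  by rewrite -itgZ//; apply: eq_itg => x _; rewrite /h; field.
- move=> s Z s0 uZ.
  have := @itg_deriv_interp_low_le R n n0 (sq s) (dsq s) (dsqE s) (cdsq s) (sq01 s).
  have := energy_dsq uZ; set D := itg 0 1 (fun x => dsq s x ^+ 2) => D1 D2.
  have ce : continuous (fun x => Sd s x ^+ 2) by apply: cont_exp; exact: cont_trig.
  rewrite (_ : itg _ _ _ = 4^-1 * itg 0 1 (fun x => Sd s x ^+ 2)).
    by move: D2; rewrite -/(F2 s) -/(Sd s); lra.
  by rewrite -itgZ//; apply: eq_itg => x _; rewrite evolution; field.
- by move=> s; rewrite uE uxE; exact: bernstein.
- exact: e0.
- exact: M0.
Qed.

End DiscreteBurgers.

(** * Fourier coefficients *)

Section Uniqueness.
Context {R : realType}.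
Implicit Types (f g h : R -> R) (x y : R) (z : int).

Definition cosz z x : R := cos (2 * pi * z%:~R * x).
Definition sinz z x : R := sin (2 * pi * z%:~R * x).

Let ccosz z : continuous (cosz z). Proof. exact: cont_cosl. Qed.
Let csinz z : continuous (sinz z). Proof. exact: cont_sinl. Qed.
Arguments ccosz : clear implicits.
Arguments csinz : clear implicits.

Let coszD z x : cosz (z + 1) x = cosz z x * cosz 1 x - sinz z x * sinz 1 x.
Proof. by rewrite /cosz /sinz -cosD rmorphD mulrDr mulrDl. Qed.
Let coszB z x : cosz (z - 1) x = cosz z x * cosz 1 x + sinz z x * sinz 1 x.
Proof. by rewrite /cosz /sinz -cosB rmorphB mulrBr mulrBl. Qed.
Let sinzD z x : sinz (z + 1) x = sinz z x * cosz 1 x + cosz z x * sinz 1 x.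
Proof. by rewrite /cosz /sinz -sinD rmorphD mulrDr mulrDl. Qed.
Let sinzB z x : sinz (z - 1) x = sinz z x * cosz 1 x - cosz z x * sinz 1 x.
Proof. by rewrite /cosz /sinz -sinB rmorphB mulrBr mulrBl. Qed.

Section Annihilator.
Context (g : R -> R) (cg : continuous g).
Context (gcos : forall z, itg 0 1 (fun x => g x * cosz z x) = 0).
Context (gsin : forall z, itg 0 1 (fun x => g x * sinz z x) = 0).

(** A trigonometric polynomial of degree 1 which, for the radii used below, exceeds 1 within
    distance d of x0 and has absolute value at most 1 on the rest of the period; its powers
    concentrate at x0. *)
Let peak x0 d x : R := 1 - cos (2 * pi * d) + cos (2 * pi * (x - x0)).

Let peakE x0 d x : peak x0 d x = 1 - cos (2 * pi * d) +
  cos (2 * pi * x0) * cosz 1 x + sin (2 * pi * x0) * sinz 1 x.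
Proof.
rewrite /peak /cosz /sinz mulr1 mulrBr [2 * pi * x - _]addrC cosD cosN sinN.
by ring.
Qed.

Let cpeak x0 d : continuous (peak x0 d).
Proof.
have -> : peak x0 d = fun x => 1 - cos (2 * pi * d) +
  cos (2 * pi * x0) * cosz 1 x + sin (2 * pi * x0) * sinz 1 x.
  by apply/funext => x; exact: peakE.
apply: cont_add; last exact: cont_scale.
by apply: cont_add; [exact: cst_continuous|exact: cont_scale].
Qed.
Arguments cpeak : clear implicits.

(* The functions annihilated by all modes are stable under multiplication by a mode. *)
Let annihilated_peak x0 d m : forall z,
  itg 0 1 (fun x => g x * peak x0 d x ^+ m * cosz z x) = 0 /\
  itg 0 1 (fun x => g x * peak x0 d x ^+ m * sinz z x) = 0.
Proof.
elim: m => [|m IH] z.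
  by split; [rewrite -[RHS](gcos z)|rewrite -[RHS](gsin z)];
    apply: eq_itg => x _; rewrite expr0 mulr1.
pose G x := g x * peak x0 d x ^+ m.
have cG : continuous G by apply: cont_mul => //; apply: cont_exp; exact: cpeak.
pose al := 1 - cos (2 * pi * d); pose be := cos (2 * pi * x0); pose ga := sin (2 * pi * x0).
have cGc w : continuous (fun x => G x * cosz w x) by exact: cont_mul.
have cGs w : continuous (fun x => G x * sinz w x) by exact: cont_mul.
have expand (H : R -> R) (s : R) (e1 e2 : int -> R -> R) :
    (forall w, continuous (fun x => G x * e1 w x)) ->
    (forall w, continuous (fun x => G x * e2 w x)) ->
    (forall w, itg 0 1 (fun x => G x * e1 w x) = 0) ->
    (forall w, itg 0 1 (fun x => G x * e2 w x) = 0) ->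
    (forall x, H x = al * (G x * e1 z x) + (be / 2) * (G x * e1 (z + 1) x) +
      (be / 2) * (G x * e1 (z - 1) x) + s * (G x * e2 (z + 1) x)
      + (- s) * (G x * e2 (z - 1) x)) -> itg 0 1 H = 0.
  move=> c1 c2 z1 z2 HE; rewrite (eq_itg (fun x _ => HE x)).
  rewrite !itgD ?itgZ ?z1 ?z2 ?mulr0 ?addr0//; repeat first [apply: cont_add | exact: cont_scale].
split.
  apply: (expand _ (ga / 2) cosz sinz) => //.
  - by move=> w; have [] := IH w.
  - by move=> w; have [] := IH w.
  move=> x; rewrite exprSr /G; move: (peak x0 d x ^+ m) => W.
  by rewrite peakE coszD coszB sinzD sinzB -/al -/be -/ga; field.
apply: (expand _ (- ga / 2) sinz cosz) => //.
- by move=> w; have [] := IH w.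
- by move=> w; have [] := IH w.
move=> x; rewrite exprSr /G; move: (peak x0 d x ^+ m) => W.
by rewrite peakE coszD coszB sinzD sinzB -/al -/be -/ga; field.
Qed.

(** The reflection of s to 1 - s reduces to s <= 1 / 2, where the cosine decreases. *)
Let cos_far (d s : R) : 0 < d -> d <= s <= 1 - d -> cos (2 * pi * s) <= cos (2 * pi * d).
Proof.
move=> d0 /andP[ds sd]; have p0 := @pi_gt0 R.
wlog s2 : s ds sd / s <= 1 / 2.
  move=> H; have [s2|s2] := leP s (1 / 2); first exact: H.
  have -> : cos (2 * pi * s) = cos (2 * pi * (1 - s)).
    rewrite -cosN (_ : 2 * pi * (1 - s) = - (2 * pi * s) + pi *+ 2) ?cosD2pi//.
    by rewrite -mulr_natl; ring.
  by apply: H; lra.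
move: ds; rewrite le_eqVlt => /predU1P[->//|ds].
rewrite ltW// ltr_cos ?in_itv/=; first by nra.
  by apply/andP; split; nra.
by apply/andP; split; nra.
Qed.

(** The integral of g times the m-th power of the peak is 0. A window around x0 contributes at least
    (g(x0) / 2) q^m d with q > 1, and the two remaining pieces of [0, 1] at least - B each, which is
    impossible for large m. *)
Lemma annihilated_not_pos (x0 : R) : 0 < x0 < 1 -> ~ (0 < g x0).
Proof.
move=> /andP[x00 x01] g0; have p0 := @pi_gt0 R.
have [d [d0 dx0 dx1 gd]] : exists d : R, [/\ 0 < d, d <= x0, d <= 1 - x0 &
    forall x, `|x - x0| <= d -> g x0 / 2 <= g x].
  have e0 : 0 < g x0 / 2 by lra.
  have /cvgrPdist_le/(_ _ e0) := @cg x0.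
  move=> [d /= d0 H].
  (* Half the continuity radius allows a non-strict condition on the distance; x0 and 1 - x0 keep
     the window inside [0, 1]. *)
  exists (Num.min (d / 2) (Num.min x0 (1 - x0))); split.
  - by rewrite !lt_min; apply/and3P; split; lra.
  - by rewrite ge_min ge_min lexx orbT.
  - by rewrite ge_min ge_min lexx !orbT.
  - move=> x; rewrite le_min => /andP[xd _].
    have /H /= : ball_ (fun x => `|x|) x0 d x by rewrite /ball_/= distrC; lra.
    by rewrite ler_norml => /andP[_]; lra.
have [B B0 gB] : exists2 B : R, 0 <= B & forall x, 0 <= x <= 1 -> `|g x| <= B.
  have cng := cont_norm cg.
  have [c c01 fc] := @EVT_max _ _ _ _ ler01 (continuous_subspaceT cng).
  by exists `|g c| => // x xab; apply: fc; rewrite in_itv.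
(* The least value of the peak within distance d / 2 of x0. *)
pose q := peak x0 d (x0 + d / 2).
have peak_in x : `|x - x0| <= d / 2 -> q <= peak x0 d x.
  move=> xd; rewrite /q /peak lerD2l.
  rewrite [x0 + _]addrC addrK -[cos (2 * pi * (x - x0))]cos_norm normrM.
  rewrite [`|2 * pi|]ger0_norm; last by lra.
  move: xd; rewrite le_eqVlt => /predU1P[->//|xd].
  have := normr_ge0 (x - x0) => ax.
  rewrite ltW// ltr_cos ?in_itv/=; first by nra.
    by apply/andP; split; nra.
  by apply/andP; split; nra.
have q1 : 1 < q.
  rewrite /q /peak [x0 + _]addrC addrK; suff : cos (2 * pi * d) < cos (2 * pi * (d / 2)) by lra.
  by rewrite ltr_cos ?in_itv/=; [nra|apply/andP; split; nra..].
have peak_mid x : `|x - x0| <= d -> 0 <= peak x0 d x.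
  move=> xd; rewrite /peak -[cos (2 * pi * (x - x0))]cos_norm normrM.
  rewrite [`|2 * pi|]ger0_norm; last by lra.
  have : cos (2 * pi * d) <= cos (2 * pi * `|x - x0|).
    move: xd; rewrite le_eqVlt => /predU1P[->//|xd].
    have := normr_ge0 (x - x0) => ax.
    rewrite ltW// ltr_cos ?in_itv/=; first by nra.
      by apply/andP; split; nra.
    by apply/andP; split; nra.
  by lra.
have peak_out x : 0 <= x <= 1 -> d < `|x - x0| -> `|peak x0 d x| <= 1.
  move=> /andP[x0' x1'] xd.
  have h : d <= `|x - x0| <= 1 - d.
    by rewrite ltW//= ler_norml; apply/andP; split; lra.
  have := cos_far d0 h.
  rewrite /peak -[cos (2 * pi * (x - x0))]cos_norm normrM.
  rewrite [`|2 * pi|]ger0_norm; last by lra.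
  have := cos_le1 (2 * pi * d); have := cos_geN1 (2 * pi * `|x - x0|).
  by move=> *; rewrite ler_norml; apply/andP; split; lra.
have key m : g x0 / 2 * q ^+ m * d <= 2 * B.
  have [+ _] := annihilated_peak x0 d m 0.
  pose W x := g x * peak x0 d x ^+ m.
  have cW : continuous W by apply: cont_mul => //; apply: cont_exp; exact: cpeak.
  rewrite (@eq_itg _ _ _ _ W); last first.
    by move=> x _; rewrite /cosz mulr0 mul0r cos0 mulr1.
  have l1 : 0 <= x0 - d / 2 by lra.
  have l2 : x0 - d / 2 <= x0 + d / 2 by lra.
  have l3 : x0 + d / 2 <= 1 by lra.
  rewrite (itg_split (le_trans l1 l2) l3)// (itg_split l1 l2)//.
  have WB x : 0 <= x <= 1 -> - B <= W x.
    move=> x01'; rewrite /W; have [xd|xd] := leP `|x - x0| d.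
      apply: (@le_trans _ _ 0); first by lra.
      rewrite mulr_ge0 ?exprn_ge0 ?peak_mid//.
      by apply: le_trans (gd _ xd); lra.
    have : `|g x * peak x0 d x ^+ m| <= B.
      rewrite normrM normrX -[leRHS]mulr1 ler_pM ?exprn_ge0 ?gB//.
      by rewrite exprn_ile1 ?peak_out.
    by rewrite ler_norml => /andP[].
  have side a b : 0 <= a -> a <= b -> b <= 1 -> - B <= itg a b W.
    move=> a0 ab b1; apply: (@le_trans _ _ (itg a b (fun=> - B))).
      by rewrite itg_cst//; nra.
    apply: itg_le => //; first exact: cst_continuous.
    move=> x /andP[ax xb]; apply: WB; apply/andP; split; lra.
  have s1 := side 0 (x0 - d / 2) (lexx 0) l1 ltac:(lra).
  have s2 := side (x0 + d / 2) 1 ltac:(lra) l3 (lexx 1).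
  have mid : g x0 / 2 * q ^+ m * d <= itg (x0 - d / 2) (x0 + d / 2) W.
    have -> : g x0 / 2 * q ^+ m * d =
        itg (x0 - d / 2) (x0 + d / 2) (fun=> g x0 / 2 * q ^+ m).
      by rewrite itg_cst//; congr (_ * _); field.
    apply: itg_le => //; first exact: cst_continuous.
    move=> x /andP[xl xr].
    have xd : `|x - x0| <= d / 2 by rewrite ler_norml; apply/andP; split; lra.
    rewrite /W ler_pM ?exprn_ge0//; [by lra|by lra|by apply: gd; lra|].
    by rewrite lerXn2r ?nnegrE ?peak_in//; [lra|apply: le_trans (peak_in _ xd); lra].
  by lra.
(* Bernoulli's inequality makes the growth of q^m explicit, so that the Archimedean property yields
   the contradiction. *)
have bern m : 1 + m%:R * (q - 1) <= q ^+ m.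
  elim: m => [|m IH]; first by rewrite mul0r addr0.
  rewrite exprS -[m.+1%:R]natr1.
  have : q * (1 + m%:R * (q - 1)) <= q * q ^+ m by rewrite ler_wpM2l//; lra.
  have : 0 <= m%:R * (q - 1) ^+ 2 by rewrite mulr_ge0 ?sqr_ge0.
  by lra.
have pos : 0 < g x0 / 2 * d * (q - 1).
  by apply: mulr_gt0; [apply: mulr_gt0|]; lra.
have [m hm] : exists m : nat, 2 * B / (g x0 / 2 * d * (q - 1)) < m%:R.
  exists (Num.Def.archi_bound (2 * B / (g x0 / 2 * d * (q - 1)))).
  by apply: archi_boundP; apply: divr_ge0; [exact: mulr_ge0|exact: ltW].
move: hm; rewrite ltr_pdivrMr// => hm.
have := key m; have := bern m.
have gd0 : 0 < g x0 / 2 * d by rewrite mulr_gt0//; lra.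
nra.
Qed.

End Annihilator.

(** Both signs of g are excluded. The open interval leaves room for a window around the point; the
    end points are settled later by periodicity. *)
Lemma fourier_uniqueness g : continuous g ->
  (forall z, itg 0 1 (fun x => g x * cosz z x) = 0) ->
  (forall z, itg 0 1 (fun x => g x * sinz z x) = 0) ->
  forall x, 0 < x < 1 -> g x = 0.
Proof.
move=> cg gc gs x x01; have [gx|gx|//] := ltgtP (g x) 0; exfalso; last first.
  exact: (annihilated_not_pos cg gc gs x01 gx).
have cg' : continuous (fun x => -1 * g x) by exact: cont_scale.
apply: (@annihilated_not_pos (fun x => -1 * g x) cg' _ _ x x01); last by lra.
- move=> z; transitivity (-1 * itg 0 1 (fun x => g x * cosz z x)).
    by rewrite -itgZ; [apply: eq_itg => y _; rewrite mulrA|exact: cont_mul].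
  by rewrite gc mulr0.
- move=> z; transitivity (-1 * itg 0 1 (fun x => g x * sinz z x)).
    by rewrite -itgZ; [apply: eq_itg => y _; rewrite mulrA|exact: cont_mul].
  by rewrite gs mulr0.
Qed.

End Uniqueness.

(** * Integrals and norms on the torus *)

Section TorusNorms.
Context {R : realType}.
Implicit Types (f g : R -> R) (x y : R).

Notation mu := (@lebesgue_measure R).
Notation nu := (@torus_measure R).
Notation I01 := (`[(0 : R), 1[%classic).

Let mI : measurable I01. Proof. exact: measurable_itv. Qed.

Let nuC : nu (~` I01) = 0%E.
Proof. by rewrite /torus_measure /mrestr setICl measure0. Qed.

Let ge0_integral_torus (F : R -> \bar R) : measurable_fun setT F ->
  (forall x, 0 <= F x)%E ->
  (\int[nu]_x F x = \int[mu]_(x in I01) F x)%E.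
Proof.
move=> mF F0; rewrite -(setUv I01) ge0_integral_setU//.
- rewrite [X in (_ + X)%E]null_set_integral ?adde0//.
  + by apply: eq_measure_integral => A mA AI; rewrite -[in RHS](setIidl AI).
  + exact: measurableC.
  + exact: measurable_funS mF.
- exact: measurableC.
- by rewrite setUv.
- by apply/disj_set2P; rewrite setICr.
Qed.

Lemma integral_torus (F : R -> \bar R) : measurable_fun setT F ->
  (\int[nu]_x F x = \int[mu]_(x in I01) F x)%E.
Proof.
move=> mF; rewrite integralE [RHS]integralE !ge0_integral_torus//.
- exact: measurable_funeneg.
- exact: measurable_funepos.
Qed.

Let measurable_EFin_cont f : continuous f -> measurable_fun setT (EFin \o f).
Proof. by move=> cf; apply/measurable_EFinP; exact: continuous_measurable_fun. Qed.

Lemma Rintegral_torus f : continuous f -> \int[nu]_x f x = itg 0 1 f.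
Proof.
move=> cf; rewrite /Rintegral integral_torus; last first.
  exact: measurable_EFin_cont.
apply: (@Rintegral_itv_bndo_bndc R (BLeft 0) 1 f).
by apply: integrableS (itg_integrable 0 1 cf) => //; apply: subset_itv_co_cc.
Qed.

Lemma L2norm_sqr f : continuous f -> L2norm f ^+ 2 = itg 0 1 (fun x => f x ^+ 2).
Proof.
move=> cf; rewrite /L2norm unlock.
have c2 := cont_exp 2 cf.
have I0 : 0 <= itg 0 1 (fun x => f x ^+ 2) by apply: itg_ge0 => *; exact: sqr_ge0.
have -> : (\int[nu]_x (`|(EFin \o f) x| `^ 2))%E = (itg 0 1 (fun x => f x ^+ 2))%:E.
  rewrite -Rintegral_torus// /Rintegral fineK.
    apply: eq_integral => x _ /=; rewrite powR_mulrn//.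
    by rewrite real_normK// num_real.
  rewrite integral_torus; last exact: (measurable_EFin_cont c2).
  apply: integrable_fin_num => //.
  by apply: integrableS (itg_integrable 0 1 c2) => //; apply: subset_itv_co_cc.
by rewrite /= powR12_sqrt// sqr_sqrtr.
Qed.

(** If the essential supremum were below |f x|, continuity would place an interval to the right of x
    inside the exceptional null set. A right interval stays within [0, 1[ even for x = 0. *)
Lemma le_Linfnorm f x : continuous f -> 0 <= x < 1 -> (`|f x|%:E <= Linfnorm f)%E.
Proof.
move=> cf /andP[x0 x1].
have nuT : (0 < nu setT)%E.
  rewrite /torus_measure /mrestr setTI lebesgue_measure_itv/= lte_fin ltr01.
  by rewrite sube0 lte_fin ltr01.
rewrite /Linfnorm unlock nuT leNgt; apply/negP => Lf.
set L := ess_sup _ _ in Lf.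
have [l Ll lf] : exists2 l : R, (L <= l%:E)%E & l < `|f x|.
  move: Lf; case: L => [l||]; first by rewrite lte_fin => lf; exists l.
    by rewrite ltNge leey.
  by move=> _; exists (`|f x| - 1); [rewrite leNye|lra].
have e0 : 0 < `|f x| - l by rewrite subr_gt0.
have cn := cont_norm cf.
have /cvgrPdist_lt/(_ _ e0) := @cn x.
move=> [d /= d0 H].
pose e := Num.min d (1 - x).
have e_gt0 : 0 < e by rewrite lt_min d0; lra.
have [A [mA nuA AS]] := ess_sup_ge nu (abse \o (EFin \o f)).
pose J : set R := `]x, (x + e)[%classic.
have sub : J `<=` A `&` I01.
  move=> y; rewrite /J /= !in_itv/= => /andP[xy ye]; split.
    apply: AS => /= /le_trans/(_ Ll); rewrite lee_fin => fl.
    have : ball_ (fun x => `|x|) x d y.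
      rewrite /ball_/= distrC ger0_norm; last by lra.
      have : e <= d by rewrite /e ge_min lexx.
      by lra.
    by move=> /H /=; rewrite ltr_norml => /andP[_]; lra.
  have : e <= 1 - x by rewrite /e ge_min lexx orbT.
  by lra.
have : (mu J <= nu A)%E.
  apply: (@le_measure _ _ _ mu); rewrite ?inE; [exact: measurable_itv| |exact: sub].
  exact: measurableI.
rewrite nuA /J lebesgue_measure_itv/= lte_fin ltrDl e_gt0.
by rewrite -EFinB addrAC subrr add0r lee_fin leNgt e_gt0.
Qed.

End TorusNorms.

(** * Periodic functions *)

Section Periodic.
Context {R : realType}.
Implicit Types (f g : R -> R) (x : R) (z : int).

Lemma periodic_int f z x : periodic f 1 -> f (x + z%:~R) = f x.
Proof.
move=> pf; case: z => m; first exact: periodicn.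
rewrite NegzE mulrNz -(periodicn pf m.+1); congr f.
by rewrite -pmulrn subrK.
Qed.

(** A point is moved into [0, 1[ by its integer part; at 0 continuity forces the value, since zeros
    accumulate from the right. *)
Lemma periodic_eq0 g : periodic g 1 -> continuous g ->
  (forall x, 0 < x < 1 -> g x = 0) -> forall x, g x = 0.
Proof.
move=> pg cg g0 x.
have -> : g x = g (x - (Num.floor x)%:~R) by rewrite -[LHS](@periodic_int g (- Num.floor x))// rmorphN.
have [y0 y1] : 0 <= x - (Num.floor x)%:~R /\ x - (Num.floor x)%:~R < 1.
  have /andP[] := floor_itv x; rewrite rmorphD/=; lra.
move: (x - _) y0 y1 => y; rewrite le_eqVlt => /predU1P[<-|y0] y1; last by rewrite g0 ?y0.
apply/eqP; apply: contraT => gn0; have e0 : 0 < `|g 0| by rewrite normr_gt0.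
have /cvgrPdist_lt/(_ _ e0) := @cg 0.
move=> [d /= d0 H].
pose t := Num.min (d / 2) (1 / 2).
have t0 : 0 < t by rewrite lt_min; apply/andP; split; lra.
have td : t <= d / 2 by rewrite ge_min lexx.
have t2 : t <= 1 / 2 by rewrite ge_min lexx orbT.
have td' : t < d by lra.
have : ball_ (fun x : R => `|x|) 0 d t by rewrite /ball_/= sub0r normrN gtr0_norm.
have t01 : 0 < t < 1 by rewrite t0/=; lra.
move=> /H /=; rewrite (g0 t t01).
by rewrite subr0 ltxx.
Qed.

End Periodic.

(** * Band-limited functions as trigonometric polynomials *)

Section FourierCoefficients.
Local Open Scope complex_scope.
Context {R : realType}.

Implicit Types (f : R -> R) (k : nat) (z : int).

Lemma fourier_coefE f z : continuous f -> fourier_coef f z =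
  (itg 0 1 (fun x => f x * cosz z x)) +i* (- itg 0 1 (fun x => f x * sinz z x)).
Proof.
move=> cf.
have cc : continuous (fun x => f x * cosz z x) by apply: cont_mul => //; exact: cont_cosl.
have cs : continuous (fun x => -1 * (f x * sinz z x)).
  by apply: cont_scale; apply: cont_mul => //; exact: cont_sinl.
have cs' : continuous (fun x => f x * sinz z x) by apply: cont_mul => //; exact: cont_sinl.
rewrite /fourier_coef /cintegral; congr (_ +i* _).
  rewrite -Rintegral_torus//; apply: eq_Rintegral => x _ /=.
  by rewrite mul0r subr0 mulrN cosN mulrA.
rewrite -mulN1r -itgZ// -Rintegral_torus//; apply: eq_Rintegral => x _ /=.
by rewrite mul0r addr0 mulrN sinN mulrN mulN1r mulrA.
Qed.

Lemma cosz_Negz k (x : R) : cosz (Negz k) x = cos (tau k.+1 * x).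
Proof. by rewrite /cosz NegzE mulrNz mulrN mulNr cosN. Qed.

Lemma sinz_Negz k (x : R) : sinz (Negz k) x = - sin (tau k.+1 * x).
Proof. by rewrite /sinz NegzE mulrNz mulrN mulNr sinN. Qed.

(** The candidate carries the real Fourier coefficients of f, and f minus the candidate is
    annihilated by all modes. For real f, equality of the two extreme coefficients reads B n = - B
    n, so there is no top sine mode. *)
Lemma band_limited_trig (n : nat) f : periodic f 1 -> continuous f ->
  (forall z : int, (n < absz z)%N -> fourier_coef f z = 0) ->
  fourier_coef f n%:Z = fourier_coef f (- n%:Z) ->
  exists a b : nat -> R, b n = 0 /\ f = trig n.+1 a b.
Proof.
move=> pf cf band sym.
pose A k := itg 0 1 (fun x => f x * cos (tau k * x)).
pose B k := itg 0 1 (fun x => f x * sin (tau k * x)).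
have AB z : fourier_coef f z = A (absz z) +i* (- (sgz z)%:~R * B (absz z)).
  rewrite fourier_coefE//; case: z => k.
    congr (_ +i* _) => //; case: k => [|k]; last by rewrite mulN1r.
    rewrite sgz0 oppr0 mul0r -mulN1r -itgZ; last by apply: cont_mul => //; exact: cont_sinl.
    rewrite -[RHS](mul0r (1 - 0)) -itg_cst//; apply: eq_itg => x _.
    by rewrite /sinz mulr0 mul0r sin0 !mulr0.
  congr (_ +i* _).
    by apply: eq_itg => x _; rewrite cosz_Negz.
  rewrite -mulN1r -itgZ; last by apply: cont_mul => //; exact: cont_sinl.
  rewrite opprK mul1r; apply: eq_itg => x _.
  by rewrite sinz_Negz mulrN mulN1r opprK.
have A0 k : (n < k)%N -> A k = 0.
  by move=> nk; have := band k%:Z nk; rewrite AB => -[].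
have B0 k : (n < k)%N -> B k = 0.
  move=> nk; have := band k%:Z nk; rewrite AB => -[_] /eqP.
  by rewrite gtr0_sgz ?ltz_nat ?(leq_ltn_trans _ nk)// mulN1r oppr_eq0 => /eqP.
have Bn : B n = 0.
  case: n sym {band A0 B0} => [|n] sym.
    rewrite /B -[RHS](mul0r (1 - 0)) -itg_cst//; apply: eq_itg => x _.
    by rewrite /tau mulr0 mul0r sin0 mulr0.
  have := congr1 (@complex.Im R) sym; rewrite !AB /=.
  by rewrite sgzN gtr0_sgz// rmorphN opprK mul1r mulN1r; lra.
pose a k := if k == 0%N then A 0%N else 2 * A k.
pose b k := 2 * B k.
exists a, b; split; first by rewrite /b Bn mulr0.
(* Vanishing coefficients allow the degree to be raised at will, so that the orthogonality
   relations, stated for modes up to the degree, reach every k. *)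
have pad m : (n <= m)%N -> trig n.+1 a b = trig m.+1 a b.
  move=> nm; apply/funext => x; rewrite /trig.
  rewrite (big_ord_widen m.+1 (fun k => a k * cos (tau k * x) + b k * sin (tau k * x)))//.
  rewrite big_mkcond; apply: eq_bigr => k _; case: ifP => // /negbT; rewrite -leqNgt => nk.
  have kz : (k == 0%N :> nat) = false by move: nk; case: (k : nat).
  by rewrite /a /b kz (A0 _ nk) (B0 _ nk) !mulr0 !mul0r addr0.
have ct : continuous (trig n.+1 a b) by exact: cont_trig.
have diff z (e : R -> R) : continuous e ->
    itg 0 1 (fun x => (f x - trig n.+1 a b x) * e x) =
    itg 0 1 (fun x => f x * e x) - itg 0 1 (fun x => trig n.+1 a b x * e x).
  move=> ce; rewrite -itgB; [|exact: cont_mul..].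
  by apply: eq_itg => x _; rewrite mulrBl.
have gc k : itg 0 1 (fun x => (f x - trig n.+1 a b x) * cos (tau k * x)) = 0.
  rewrite (diff 0)//; last exact: cont_cosl.
  rewrite (pad (maxn n k)) ?leq_maxl//.
  rewrite (mean_trig_cos (n := maxn n k) (@itgD _ 0 1) (@itgZ _ 0 1) (itg_cos 0) _
    (fun r _ => itg_sin r)) ?leq_maxr//; last first.
    by move=> r /andP[r0 _]; rewrite itg_cos gtn_eqF.
  rewrite /cos_weight itg_cos double_eq0 -/(A k) /a.
  by case: eqP => [->|_] /=; rewrite ?mulr1n ?mulr0n; field.
have gs k : itg 0 1 (fun x => (f x - trig n.+1 a b x) * sin (tau k * x)) = 0.
  rewrite (diff 0)//; last exact: cont_sinl.
  rewrite (pad (maxn n k)) ?leq_maxl//.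
  rewrite (mean_trig_sin (n := maxn n k) (@itgD _ 0 1) (@itgZ _ 0 1) (itg_cos 0) _
    (fun r _ => itg_sin r)) ?leq_maxr//; last first.
    by move=> r /andP[r0 _]; rewrite itg_cos gtn_eqF.
  rewrite /sin_weight itg_cos double_eq0 -/(B k) /b.
  case: eqP => [->|_] /=; rewrite ?mulr1n ?mulr0n; last by field.
  rewrite subrr mulr0 mul0r subr0 /B -[RHS](mul0r (1 - 0)) -itg_cst//.
  by apply: eq_itg => x _; rewrite /tau mulr0 mul0r sin0 mulr0.
have cg : continuous (fun x => f x - trig n.+1 a b x) by exact: cont_sub.
have g0 := @fourier_uniqueness R _ cg _ _.
apply/funext => x; apply/eqP; rewrite -subr_eq0; apply/eqP; move: x.
apply: periodic_eq0 => //.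
  by move=> x; rewrite /= pf trig_periodic.
apply: g0 => z.
  case: z => k; first exact: gc.
  rewrite -[RHS](gc k.+1); apply: eq_itg => x _.
  by rewrite cosz_Negz.
case: z => k; first exact: gs.
transitivity (-1 * itg 0 1 (fun x => (f x - trig n.+1 a b x) * sin (tau k.+1 * x))).
  rewrite -itgZ; last by apply: cont_mul => //; exact: cont_sinl.
  by apply: eq_itg => x _; rewrite sinz_Negz mulrN mulN1r.
by rewrite gs mulr0.
Qed.

End FourierCoefficients.

(** * The discrete operators in real form *)

Section Operators.
Local Open Scope complex_scope.
Context {R : realType}.

Lemma Re_sum (I : Type) (r : seq I) (F : I -> R[i]) :
  complex.Re (\sum_(i <- r) F i) = \sum_(i <- r) complex.Re (F i).
Proof.
elim: r => [|i r IH]; first by rewrite !big_nil.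
by rewrite !big_cons -IH; case: (F i) => a b; case: (\sum_(j <- r) F j).
Qed.

Lemma Im_sum (I : Type) (r : seq I) (F : I -> R[i]) :
  complex.Im (\sum_(i <- r) F i) = \sum_(i <- r) complex.Im (F i).
Proof.
elim: r => [|i r IH]; first by rewrite !big_nil.
by rewrite !big_cons -IH; case: (F i) => a b; case: (\sum_(j <- r) F j).
Qed.

Context (n : nat) (n0 : (0 < n)%N).
Local Notation N := (n.*2).
Implicit Types (t : R) (U : 'cV[R]_N) (z : int) (F : nat -> R).

(** Sequences over nat are what the grid lemmas take; the default 0 is harmless because the
    coefficients read only the entries below N. *)
Definition samples U (j : nat) : R := if insub j is Some i then U i 0 else 0.

Lemma samplesE U (i : 'I_N) : samples U i = U i 0.
Proof. by rewrite /samples valK. Qed.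

Let alpha F z : R := N%:R^-1 * \sum_(j < N) F j * cosz z (grid_node n j).
Let beta F z : R := N%:R^-1 * \sum_(j < N) F j * sinz z (grid_node n j).

Lemma dftE U z : dft U z = alpha (samples U) z +i* (- beta (samples U) z).
Proof.
have NC : (N%:R^-1 : R[i]) = (N%:R^-1)%:C by rewrite fmorphV rmorph_nat.
rewrite /dft NC [X in _ * X](_ : _ =
   (\sum_(j < N) U j 0 * cosz z (grid_node n j)) +i* (- \sum_(j < N) U j 0 * sinz z (grid_node n j))).
  rewrite /alpha /beta; under [X in _ * X +i* _]eq_bigr do rewrite samplesE.
  under [X in _ +i* - (_ * X)]eq_bigr do rewrite samplesE.
  apply/eqP; rewrite eq_complex /= !mul0r subr0 addr0 mulrN !eqxx.
  by [].
apply/eqP; rewrite eq_complex Re_sum Im_sum /= -sumrN; apply/andP; split; apply/eqP.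
  by apply: eq_bigr => j _; rewrite /= mul0r subr0 mulrN cosN mulrA.
by apply: eq_bigr => j _; rewrite /= mul0r addr0 mulrN sinN mulrN mulrA.
Qed.

Let cexp2piE z (i : 'I_N) :
  cexp2pi (z%:~R * grid R i) = cosz z (grid_node n i) +i* sinz z (grid_node n i).
Proof. by rewrite /cexp2pi mulrA. Qed.

Let alphaN F z : alpha F (- z) = alpha F z.
Proof.
rewrite /alpha; congr (_ * _); apply: eq_bigr => j _.
by rewrite /cosz mulrNz mulrN mulNr cosN.
Qed.

Let betaN F z : beta F (- z) = - beta F z.
Proof.
rewrite /beta -mulrN -sumrN; congr (_ * _); apply: eq_bigr => j _.
by rewrite /sinz mulrNz mulrN mulNr sinN mulrN.
Qed.

Let alpha_wt F k : mode_weight n k * alpha F k%:Z = cos_coefficient n F k.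
Proof. by rewrite /alpha /cos_coefficient mulrA. Qed.

Let beta_wt F k : mode_weight n k * beta F k%:Z = sin_coefficient n F k.
Proof. by rewrite /beta /sin_coefficient mulrA. Qed.

(** The real part of the summand is even in the frequency, since the sine coefficient and the sine
    change sign together; so the sum over - n < z <= n folds onto the modes 0, ..., n. *)
Lemma Delta_h_samples U i : Delta_h U i 0 = laplacian_samples n (samples U) i.
Proof.
pose F := samples U; pose x : R := grid_node n i.
pose G z : R := - (4 * pi ^+ 2 * z%:~R ^+ 2) * (alpha F z * cosz z x + beta F z * sinz z x).
rewrite /Delta_h /fourier_mult mxE Re_sum.
transitivity (\sum_(m < N) G (m%:Z - n%:Z + 1)).
  apply: eq_bigr => m _; rewrite dftE /freq doubleK.
  rewrite cexp2piE -/F /G -/x; set z := _ + 1.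
  set A := alpha F z; set B := beta F z; set C := cosz z x; set S := sinz z x.
  by rewrite /=; ring.
rewrite sum_even_modes//; last first.
  move=> z; rewrite /G alphaN betaN /cosz /sinz mulrNz sqrrN.
  by rewrite !mulrN !mulNr cosN sinN; ring.
rewrite /laplacian_samples /trig; apply: eq_bigr => k _.
by rewrite /G -alpha_wt -beta_wt -/F /cosz /sinz /tau -pmulrn; ring.
Qed.

Lemma partial_h_samples U i : partial_h U i 0 = gradient_samples n (samples U) i.
Proof.
pose F := samples U; pose x : R := grid_node n i.
pose G z : R := (2 * pi * z%:~R) * (beta F z * cosz z x - alpha F z * sinz z x).
rewrite /partial_h /fourier_mult mxE Re_sum.
transitivity (\sum_(m < N) G (m%:Z - n%:Z + 1)).
  apply: eq_bigr => m _; rewrite dftE /freq doubleK.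
  rewrite cexp2piE -/F /G -/x; set z := _ + 1.
  set A := alpha F z; set B := beta F z; set C := cosz z x; set S := sinz z x.
  by rewrite /=; ring.
rewrite sum_even_modes//; last first.
  move=> z; rewrite /G alphaN betaN /cosz /sinz mulrNz.
  by rewrite !mulrN !mulNr cosN sinN; ring.
rewrite /gradient_samples /trig; apply: eq_bigr => k _.
by rewrite /G -alpha_wt -beta_wt -/F /cosz /sinz /tau -pmulrn; ring.
Qed.

(** The solution is known only for t >= 0. Freezing it at its initial value for negative times gives
    a curve continuous on the whole line, as the integral lemmas require. *)
Lemma continuous_clamp (T : topologicalType) (U : R -> T) :
  {within `[0, +oo[, continuous U} -> continuous (fun t : R => U (Num.max 0 t)).
Proof.
move=> /subspace_continuousP cU t.
have t0 : `[0, +oo[%classic (Num.max 0 t) by rewrite /= in_itv/= andbT le_max lexx.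
have H := cU _ t0.
apply: (cvg_comp (fun t : R => Num.max 0 t) U _ H).
move=> P /= [d /= d0 dP].
have cm : continuous (fun t : R => Num.max 0 t).
  by apply: cont_max; [exact: cst_continuous|move=> x; exact: cvg_id].
have /cvgrPdist_lt/(_ _ d0) := @cm t.
apply: filterS => s ds; apply: dP; first exact: ds.
by rewrite /= in_itv/= andbT le_max lexx.
Qed.

Lemma norm_cV_le U (B : R) : 0 <= B -> (forall i, `|U i 0| <= B) -> `|U| <= B.
Proof.
move=> B0 UB; rewrite /Num.Def.normr/=; have [->//|/mx_norm_neq0[[i j] ->]] := eqVneq (mx_norm U) 0.
by rewrite ord1; exact: UB.
Qed.

Lemma burgers_solution_samples (U0 : 'cV[R]_N) (U : R -> 'cV[R]_N) :
  burgers_solution U0 U ->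
  exists v : nat -> R -> R, [/\ forall j, continuous (v j),
    forall (i : 'I_N) t, 0 <= t -> v i t = U t i 0 &
    forall j t, (j < N)%N -> 0 < t -> is_derive t 1 (v j) (burgers_rhs n (v^~ t) j)].
Proof.
move=> [cU UU0 dU].
pose v j t := samples (U (Num.max 0 t)) j.
have vE (i : 'I_N) t : 0 <= t -> v i t = U t i 0.
  by move=> t0; rewrite /v samplesE; move/max_idPr : t0 => ->.
have vmax t : 0 < t -> v^~ t = samples (U t).
  by move=> /ltW/max_idPr t0; apply/funext => j; rewrite /v t0.
exists v; split => //.
  move=> j; rewrite /v /samples; case: insubP => [i _ _|_]; last exact: cst_continuous.
  have c := continuous_clamp cU.
  move=> t; exact: (continuous_comp (@c t) (@coord_continuous _ _ _ i 0 _)).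
move=> j t jN t0; have [W [dW eqW]] := dU t t0.
pose i := Ordinal jN.
have dUi : is_derive t 1 (fun s => U s i 0) (W i 0).
  have dUt : derivable U t 1 by case: dW.
  apply: DeriveDef; first exact: ((derivable_mxP U t 1).1 dUt i 0).
  by have := derive_mx dUt; rewrite (@derive_val _ _ _ _ _ _ _ dW) => ->; rewrite mxE.
have -> : burgers_rhs n (v^~ t) j = W i 0.
  have -> : W i 0 = Delta_h (U t) i 0 - 2^-1 * partial_h (sqr_vec (U t)) i 0.
    by rewrite -eqW !mxE addrK.
  rewrite Delta_h_samples partial_h_samples vmax// /burgers_rhs; congr (_ - _ * _).
  have sq k : (k < N)%N -> samples (U t) k ^+ 2 = samples (sqr_vec (U t)) k.
    by move=> kN; rewrite -[k]/(val (Ordinal kN)) !samplesE mxE.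
  by rewrite /gradient_samples; have [-> ->] := eq_coef sq.
apply: near_eq_is_derive dUi; near=> s.
have s0 : 0 < s by near: s; exact: lt_nbhsr.
by rewrite -[j]/(val i) vE// ltW.
Unshelve. all: by end_near. Qed.

End Operators.

(* The bound of [collocation_maximum_principle] is
   Q(r) (1 + y0) / N with Q(r) = 180 (2 r^2 + K) r^2 + 2 K and
   K = exp((4 r^2 + 2) r^2), where y0 is the squared H^1 seminorm of the datum. *)
Definition overshoot_rate {R : realType} (r : R) : R :=
  let K := expR ((4 * r ^+ 2 + 2) * r ^+ 2) in
  180 * (2 * r ^+ 2 + K) * r ^+ 2 + 2 * K.

Lemma overshoot_rate_gt0 {R : realType} (r : R) : 0 < overshoot_rate r.
Proof.
rewrite /overshoot_rate; have := expR_gt0 ((4 * r ^+ 2 + 2) * r ^+ 2).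
set K := expR _ => K0; have := sqr_ge0 r => r0.
have : 0 <= K * r ^+ 2 by rewrite mulr_ge0// ltW.
have : 0 <= r ^+ 2 * r ^+ 2 by rewrite mulr_ge0.
by lra.
Qed.

Lemma archi_bound_le {R : realType} (x : R) (m : nat) : 0 <= x ->
  (Num.Def.archi_bound x <= m)%N -> x <= m%:R.
Proof.
move=> x0 xm; apply: (le_trans (ltW (archi_boundP x0))).
by rewrite ler_nat.
Qed.

(** [overshoot] is affine in y0, hence at most a multiple of 1 + y0; this is enlarged to (1 + y0)^2,
    whose square root gives the factor 1 + y0. *)
Lemma sqrt_overshoot_le {R : realType} (r y0 : R) (N : nat) : 0 <= y0 -> (0 < N)%N ->
  Num.sqrt (overshoot r y0 / N%:R) <=
  Num.sqrt (overshoot_rate r) * N%:R `^ (- 2^-1) * (1 + y0).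
Proof.
move=> y00 N0; have Np : 0 < (N%:R : R) by rewrite ltr0n.
rewrite powRN powR12_sqrt ?(ltW Np)//.
have Q0 := overshoot_rate_gt0 r.
have le : overshoot r y0 <= overshoot_rate r * (1 + y0) ^+ 2.
  apply: (@le_trans _ _ (overshoot_rate r * (1 + y0))).
    rewrite /overshoot /overshoot_rate /gradient_bound; set K := expR _.
    have := sqr_ge0 r => r0.
    have : 0 <= r ^+ 2 * r ^+ 2 * y0 by apply: mulr_ge0 => //; exact: mulr_ge0.
    by lra.
  by rewrite ler_wpM2l ?(ltW Q0)//; nra.
have h : overshoot r y0 / N%:R <=
    (Num.sqrt (overshoot_rate r) * (Num.sqrt N%:R)^-1 * (1 + y0)) ^+ 2.
  rewrite !exprMn exprVn !sqr_sqrtr ?(ltW Np) ?(ltW Q0)//.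
  by rewrite mulrAC ler_wpM2r ?invr_ge0 ?(ltW Np).
have pos : 0 <= Num.sqrt (overshoot_rate r) * (Num.sqrt N%:R)^-1 * (1 + y0).
  by rewrite !mulr_ge0 ?sqrtr_ge0 ?invr_ge0 ?sqrtr_ge0// addr_ge0.
by apply: (le_trans (ler_wsqrtr h)); rewrite sqrtr_sqr ger0_norm.
Qed.

(* `|V| for V : 'cV[R]_N is the library's max norm max_j `|V j 0|. *)
Theorem theorem1p11 (R : realType) :
  exists (N0 : R -> nat) (gamma1 : R -> R),
    (forall r : R, 0 < gamma1 r) /\
    forall (N : nat) (f : R -> R) (U : R -> 'cV[R]_N),
      (2 <= N)%N -> ~~ odd N ->
      periodic f 1 -> continuous f ->
      (forall k : int, (N./2 < absz k)%N -> fourier_coef f k = 0) ->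
      fourier_coef f (N./2)%:Z = fourier_coef f (- (N./2)%:Z) ->
      burgers_solution (\col_j f (grid R j)) U ->
      (N0 (L2norm f) <= N)%N ->
      (ereal_sup [set (`|U t|%R)%:E | t in [set t : R | (0 <= t)%R]] <=
       Linfnorm f +
       (gamma1 (L2norm f) * N%:R `^ (- 2^-1) *
        (1 + L2norm (derive1 f) ^+ 2))%R%:E)%E.
Proof.
(* The threshold guarantees N >= 1440 (r^2 + 1), under which aliasing is absorbed by the
   dissipation. *)
exists (fun r => Num.Def.archi_bound (1440 * (r ^+ 2 + 1))).
exists (fun r => Num.sqrt (overshoot_rate r)); split.
  by move=> r; rewrite sqrtr_gt0 overshoot_rate_gt0.
move=> N f U N2 oddN pf cf band sym sol Nbig.
have [n nE] : exists n, N = n.*2 by exists N./2; rewrite even_halfK.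
subst N; rewrite doubleK in band sym.
have n0 : (0 < n)%N by lia.
have [a [b [bn fE]]] := band_limited_trig pf cf band sym.
have [v [cv vU dv]] := burgers_solution_samples n0 sol.
have U0 : U 0 = \col_j f (grid R j) by case: sol.
have v0 j : (j < n.*2)%N -> v j 0 = trig n.+1 a b (grid_node n j).
  by move=> jN; rewrite (vU (Ordinal jN))// U0 mxE fE.
(* Without a top sine mode sampling loses nothing, so the initial interpolant is f and inherits its
   bound between the nodes too. *)
have u0 : interp n (v^~ 0) = f.
  apply/funext => x; rewrite /interp; have [-> ->] := eq_coef v0.
  rewrite -/(interp n _ x) interp_trig// fE /trig big_ord_recr/= bn mul0r addr0.
  by [].
have df (x : R) : is_derive x 1 f (trig n.+1 (fun k => tau k * sin_coefficient n (v^~ 0) k)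
    (fun k => - (tau k * cos_coefficient n (v^~ 0) k)) x).
  by rewrite -[f]u0; exact: der_trig.
have dfE : derive1 f = trig n.+1 (fun k => tau k * sin_coefficient n (v^~ 0) k)
    (fun k => - (tau k * cos_coefficient n (v^~ 0) k)).
  by apply/funext => x; rewrite derive1E (@derive_val _ _ _ _ _ _ _ (df x)).
have cdf : continuous (derive1 f) by rewrite dfE; exact: cont_trig.
set r := L2norm f in Nbig *.
have e0 : itg 0 1 (fun x => interp n (v^~ 0) x ^+ 2) = r ^+ 2 by rewrite u0 L2norm_sqr.
have Nr : 1440 * (r ^+ 2 + 1) <= n.*2%:R.
  have h0 : 0 <= 1440 * (r ^+ 2 + 1).
    by apply: mulr_ge0; [exact: ler0n|apply: addr_ge0; [exact: sqr_ge0|exact: ler01]].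
  exact: archi_bound_le h0 Nbig.
have Linf0 : (0 <= Linfnorm f)%E.
  by apply: le_trans (@le_Linfnorm _ f 0 cf _); rewrite ?lee_fin ?lexx ?ltr01.
have fL x : 0 <= x <= 1 -> (`|f x|%:E <= Linfnorm f)%E.
  move=> /andP[x0]; rewrite le_eqVlt => /predU1P[->|x1].
    have -> : f 1 = f 0 by rewrite -[in LHS](add0r 1) pf.
    by apply: le_Linfnorm; rewrite // lexx ltr01.
  by apply: le_Linfnorm => //; rewrite x0 x1.
(* A finite norm provides M; an infinite one makes the inequality trivial, and minus infinity
   contradicts nonnegativity. *)
case LE : (Linfnorm f) Linf0 fL => [M||] Linf0 fL; last by [].
  rewrite lee_fin in Linf0.
  have M0 x : 0 <= x <= 1 -> `|interp n (v^~ 0) x| <= M.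
    by move=> x01; rewrite u0 -lee_fin; exact: fL.
  apply: ub_ereal_sup => _ [t /= t0 <-]; rewrite -EFinD lee_fin.
  rewrite L2norm_sqr// dfE.
  set y0 := itg _ _ _.
  have y00 : 0 <= y0 by apply: itg_ge0 => *; exact: sqr_ge0.
  have N0 : (0 < n.*2)%N by lia.
  have hs := sqrt_overshoot_le r y00 N0.
  apply: norm_cV_le; first by rewrite addr_ge0// (le_trans _ hs)// sqrtr_ge0.
  move=> i; rewrite -vU//; apply: (@le_trans _ _ (M + Num.sqrt (overshoot r y0 / n.*2%:R))).
    exact: (collocation_maximum_principle n0 cv dv e0 Nr M0 t0 (ltn_ord i)).
  by rewrite lerD2l.
by rewrite addye// leey.
Qed.
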